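(* There is an algorithm which, given any word $w$ in the generators $x_0^{\pm 1}, x_1^{\pm 1}, x_2^{\pm 1},\ldots$ of Thompson's group $F$, computes the normal form of (the element of $F$ represented by) $w$ in time $O(|w|\log|w|)$.
   Context: Thompson's group is $F = \langle x_0 , x_1 , x_2 , \ldots \mid x_i^{-1} x_k x_i = x_{k+1} \ (k>i) \rangle$. For a word $w$ in the letters $x_i^{\pm 1}$, $|w|$ denotes its length (number of letters). The (classical) normal form of an element of $F$ is the unique word representing it of the form $x_{i_1} \ldots x_{i_s} x_{j_t}^{-1} \ldots x_{j_1}^{-1}$ (with $s,t\ge 0$) such that: (NF1) $i_1 \le \ldots\le i_s$ and $j_1\le \ldots \le j_t$; (NF2) if both $x_i$ and $x_i^{-1}$ occur in the word, then $x_{i+1}$ or $x_{i+1}^{-1}$ occurs, too. Time is measured as the number of elementary operations: a word is given as a list of letters (index and sign), and reading, writing, removing or appending a letter at an end of a list or stack, and comparing, adding or subtracting indices/integer counters, each count as one operation. The asymptotic bound is understood for $|w|\ge 2$. *)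

(* Defs.v *)
From Stdlib Require Import List ZArith Arith Bool Sorted.
Import ListNotations.
Set Implicit Arguments.

(** * Thompson's group F *)

(** [(i, true)] is the letter x_i and [(i, false)] is the letter x_i^{-1}. *)
Definition letter : Type := (nat * bool)%type.
Definition word : Type := list letter.

Definition pos (i : nat) : letter := (i, true).
Definition neg (i : nat) : letter := (i, false).
Definition inv (a : letter) : letter := (fst a, negb (snd a)).

Inductive F_relation : word -> word -> Prop :=
| F_conj : forall i k, i < k -> F_relation [neg i; pos k; pos i] [pos (S k)].

(** Two words are related when they represent the same element of
    F = < x_0, x_1, ... | x_i^{-1} x_k x_i = x_{k+1} (k > i) >. *)
Inductive eqF : word -> word -> Prop :=
| eqF_refl : forall u, eqF u u
| eqF_sym : forall u v, eqF u v -> eqF v u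
| eqF_trans : forall u v w, eqF u v -> eqF v w -> eqF u w
| eqF_app : forall u u' v v', eqF u u' -> eqF v v' -> eqF (u ++ v) (u' ++ v')
| eqF_cancel : forall a, eqF [a; inv a] []
| eqF_rel : forall u v, F_relation u v -> eqF u v.

Definition NF1 (v : word) : Prop :=
  exists P N : list nat,
    v = map pos P ++ map neg (rev N) /\ Sorted le P /\ Sorted le N.

Definition NF2 (v : word) : Prop :=
  forall i, In (pos i) v -> In (neg i) v ->
    In (pos (S i)) v \/ In (neg (S i)) v.

(** [v] is the one and only word that represents the same element as [w] and
    satisfies both conditions. *)
Definition is_normal_form_of (w v : word) : Prop :=
  unique (fun v' => eqF w v' /\ NF1 v' /\ NF2 v') v.

(** * Programs and their running time

    Algorithms are programs of a deeply embedded while-language. A program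
    mentions finitely many integer counters and finitely many lists of letters;
    a list is accessible only at its two ends, so it can serve as a stack or as
    a queue. Every instruction and every evaluation of a test counts as one
    elementary operation. *)

Definition counter : Type := nat.
Definition listvar : Type := nat.

Inductive list_end : Type := Front | Back.

(** The sign of an appended letter is fixed in the program text, and the sign
    of a letter in a list is accessible through the test [IsPos]. *)
Inductive instr : Type :=
| Const (r : counter) (z : Z)
| Copy (r r1 : counter)
| Add (r r1 r2 : counter)
| Sub (r r1 r2 : counter)
| ReadIndex (r : counter) (e : list_end) (l : listvar)
| Remove (e : list_end) (l : listvar)
| Append (e : list_end) (l : listvar) (r : counter) (sign : bool).

Inductive test : Type :=
| IsLt (r1 r2 : counter)
| IsEq (r1 r2 : counter)
| IsEmpty (l : listvar)
| IsPos (e : list_end) (l : listvar).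

Inductive prog : Type :=
| Skip
| Do (i : instr)
| Seq (p q : prog)
| If (b : test) (p q : prog)
| While (b : test) (p : prog).

Record state : Type := State { counters : counter -> Z; lists : listvar -> word }.

Definition update (A : Type) (f : nat -> A) (k : nat) (a : A) : nat -> A :=
  fun n => if Nat.eqb n k then a else f n.

Definition set_counter (s : state) (r : counter) (z : Z) : state :=
  State (update (counters s) r z) (lists s).

Definition set_list (s : state) (l : listvar) (u : word) : state :=
  State (counters s) (update (lists s) l u).

Definition peek (e : list_end) (u : word) : option letter :=
  match e with Front => hd_error u | Back => hd_error (rev u) end.

Definition drop_end (e : list_end) (u : word) : word :=
  match e with Front => tl u | Back => removelast u end.

Definition add_end (e : list_end) (a : letter) (u : word) : word :=
  match e with Front => a :: u | Back => u ++ [a] end.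

(** [None] is an error: access to an end of an empty list, or an attempt to
    append a letter with a negative index. *)
Definition run_instr (i : instr) (s : state) : option state :=
  match i with
  | Const r z => Some (set_counter s r z)
  | Copy r r1 => Some (set_counter s r (counters s r1))
  | Add r r1 r2 => Some (set_counter s r (counters s r1 + counters s r2)%Z)
  | Sub r r1 r2 => Some (set_counter s r (counters s r1 - counters s r2)%Z)
  | ReadIndex r e l =>
      match peek e (lists s l) with
      | Some a => Some (set_counter s r (Z.of_nat (fst a)))
      | None => None
      end
  | Remove e l =>
      match peek e (lists s l) with
      | Some _ => Some (set_list s l (drop_end e (lists s l)))
      | None => None
      end
  | Append e l r sign =>
      if (0 <=? counters s r)%Z
      then Some (set_list s l
             (add_end e (Z.to_nat (counters s r), sign) (lists s l)))
      else None
  end.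

Definition run_test (b : test) (s : state) : option bool :=
  match b with
  | IsLt r1 r2 => Some (counters s r1 <? counters s r2)%Z
  | IsEq r1 r2 => Some (counters s r1 =? counters s r2)%Z
  | IsEmpty l => Some (match lists s l with [] => true | _ :: _ => false end)
  | IsPos e l => option_map snd (peek e (lists s l))
  end.

(** [exec p s t s']: started in [s], the program [p] halts without error in
    [s'] after exactly [t] elementary operations. *)
Inductive exec : prog -> state -> nat -> state -> Prop :=
| exec_Skip : forall s, exec Skip s 0 s
| exec_Do : forall i s s', run_instr i s = Some s' -> exec (Do i) s 1 s'
| exec_Seq : forall p q s s1 s2 t1 t2,
    exec p s t1 s1 -> exec q s1 t2 s2 -> exec (Seq p q) s (t1 + t2) s2
| exec_If : forall b c p q s s' t,
    run_test b s = Some c -> exec (if c then p else q) s t s' ->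
    exec (If b p q) s (S t) s'
| exec_While_end : forall b p s,
    run_test b s = Some false -> exec (While b p) s 1 s
| exec_While_step : forall b p s s1 s2 t1 t2,
    run_test b s = Some true -> exec p s t1 s1 -> exec (While b p) s1 t2 s2 ->
    exec (While b p) s (S (t1 + t2)) s2.

Lemma exec_deterministic p s t1 s1 t2 s2 :
  exec p s t1 s1 -> exec p s t2 s2 -> t1 = t2 /\ s1 = s2.
Proof.
  intros H; revert t2 s2; induction H; intros u2 v2 H2; inversion H2; subst;
  try congruence;
  repeat match goal with
  | IH : forall t s, exec ?p ?a t s -> _, K : exec ?p ?a _ _ |- _ =>
      apply IH in K; destruct K; subst
  end; try (split; congruence).
  match goal with A : run_test ?b ?s = Some ?c, B : run_test ?b ?s = Some ?d |- _ =>
    assert (c = d) by congruence; subst end.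
  match goal with
  | IH : forall t s, exec ?p ?a t s -> _, K : exec ?p ?a _ _ |- _ =>
      apply IH in K; destruct K; subst; auto
  end.
Qed.

(** The input word is given in list 0; all other lists are empty and all
    counters are zero. The result is delivered in list 1. *)
Definition initial_state (w : word) : state :=
  State (fun _ => 0%Z) (fun l => if Nat.eqb l 0 then w else []).

Definition output (s : state) : word := lists s 1.

(* Main.v *)
From Stdlib Require Import List Reals.
From Stdlib Require Import Arith ZArith Lia Lra Sorted Bool Setoid Morphisms.
Require Import Defs.
Import ListNotations.

(** The algorithm is a merge sort. A block is a fraction: a sorted positive word
    followed by the inverse of a sorted positive word. Conjugation by [x_i]
    raises all indices above [i] by one ([eqF_shift]). When two sorted words are
    merged, a letter that has to pass over letters of the other word is smaller
    than all of them, passes over that whole word and raises it. Hence the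
    raising can be recorded in one counter, an offset, and each letter is
    touched only once. In this way
    two positive words are merged into one ([merge]), and an inverse followed by
    a positive word is turned into a fraction ([cancel]). Three such merges
    multiply two blocks in linear time ([mul]). Starting from one block for each
    letter, each pass multiplies neighbouring blocks ([pairs]) and halves their
    number, hence about [log2 |w|] linear passes leave a single block, a word
    with (NF1) that represents [w].

    Condition (NF2) fails exactly where a pair [x_i], [x_i^{-1}] encloses only
    letters of index [i] or at least [i + 2]. Removing the innermost such pair
    lowers the enclosed letters by one. If pairs are treated from the largest
    index downwards, the lowering concerns all letters treated so far, so again
    one offset suffices and the time is linear ([reduce]).

    A normal form is unique ([frac_unique]) because [F] acts on the line by
    piecewise linear homeomorphisms: if [i] is the least index of two normal
    forms of one element, the slope to the right of [i] shows that their
    exponent sums in [x_i] agree ([exponent_eqF]). Either a letter [x_i^{+-1}]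
    can be cancelled from both words at the same end, or only one of them has
    letters [x_i], in a pair [x_i u x_i^{-1}]; then [u] is the other word with
    all indices raised, so by induction [u] has no letter of index [i + 1],
    against (NF2).

    Programs are executed symbolically with a budget of operations ([runs]),
    which yields termination, correctness and running time together. *)

(** * Calculus in the group *)

#[export] Instance eqF_equivalence : Equivalence eqF.
Proof.
  split; [exact eqF_refl | exact eqF_sym | exact eqF_trans].
Qed.

#[export] Instance eqF_app_proper : Proper (eqF ==> eqF ==> eqF) (@app letter).
Proof. intros u u' Hu v v' Hv; now apply eqF_app. Qed.

Lemma inv_involutive a : inv (inv a) = a.
Proof. destruct a as [i b]; unfold inv; simpl; now rewrite negb_involutive. Qed.

Definition inverse_word (u : word) : word := map inv (rev u).

Lemma inverse_word_app u v :
  inverse_word (u ++ v) = inverse_word v ++ inverse_word u.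
Proof. unfold inverse_word; now rewrite rev_app_distr, map_app. Qed.

Lemma inverse_word_involutive u : inverse_word (inverse_word u) = u.
Proof.
  unfold inverse_word; rewrite <- map_rev, rev_involutive, map_map.
  rewrite (map_ext _ (fun a => a) inv_involutive); apply map_id.
Qed.

Lemma eqF_inverse_r u : eqF (u ++ inverse_word u) [].
Proof.
  induction u as [|a u IH]; [reflexivity|].
  change (a :: u) with ([a] ++ u); rewrite inverse_word_app.
  rewrite <- app_assoc, (app_assoc u), IH; apply eqF_cancel.
Qed.

Lemma eqF_inverse_l u : eqF (inverse_word u ++ u) [].
Proof.
  pose proof (eqF_inverse_r (inverse_word u)) as H.
  now rewrite inverse_word_involutive in H.
Qed.

Lemma eqF_cancel_l u v w : eqF (u ++ v) (u ++ w) -> eqF v w.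
Proof.
  intros H.
  assert (E : forall x, eqF x (inverse_word u ++ u ++ x))
    by (intros x; now rewrite app_assoc, eqF_inverse_l).
  now rewrite (E v), (E w), H.
Qed.

Lemma eqF_cancel_r u v w : eqF (v ++ u) (w ++ u) -> eqF v w.
Proof.
  intros H.
  assert (E : forall x, eqF x ((x ++ u) ++ inverse_word u))
    by (intros x; now rewrite <- app_assoc, eqF_inverse_r, app_nil_r).
  now rewrite (E v), (E w), H.
Qed.

Lemma eqF_inverse_word u v :
  eqF u v -> eqF (inverse_word u) (inverse_word v).
Proof.
  intros H; apply (eqF_cancel_l u); rewrite eqF_inverse_r, H.
  symmetry; apply eqF_inverse_r.
Qed.

Definition shift (u : word) : word := map (fun a => (S (fst a), snd a)) u.

(** The defining relations say that conjugation by [x_i] raises the index of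
    every letter above [i]; every rewriting below is an instance of this. *)
Lemma eqF_shift i u :
  Forall (fun a => i < fst a) u -> eqF (u ++ [pos i]) (pos i :: shift u).
Proof.
  assert (P : forall k, i < k -> eqF [pos k; pos i] [pos i; pos (S k)]).
  { intros k Hk; apply (eqF_cancel_l [neg i]).
    transitivity ([neg i; pos i] ++ [pos (S k)]).
    - rewrite (eqF_cancel (neg i)); now apply eqF_rel, F_conj.
    - reflexivity. }
  assert (L : forall a, i < fst a ->
    eqF [a; pos i] [pos i; (S (fst a), snd a)]).
  { intros [k [|]] Hk; [now apply P|]; simpl in *.
    apply (eqF_cancel_l [pos k]).
    transitivity [pos i].
    - change (eqF ([pos k; neg k] ++ [pos i]) [pos i]).
      now rewrite (eqF_cancel (pos k)).
    - change (eqF [pos i] ([pos k; pos i] ++ [neg (S k)])).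
      rewrite (P k Hk); simpl.
      change (eqF ([pos i] ++ []) ([pos i] ++ [pos (S k); neg (S k)])).
      now rewrite (eqF_cancel (pos (S k))). }
  induction 1 as [|a u Ha Hu IH]; [reflexivity|].
  change (eqF ([a] ++ (u ++ [pos i])) (pos i :: shift (a :: u))).
  rewrite IH.
  change (eqF ([a; pos i] ++ shift u) (pos i :: shift (a :: u))).
  now rewrite (L a Ha).
Qed.

Lemma eqF_shift_neg i u :
  Forall (fun a => i < fst a) u -> eqF (neg i :: u) (shift u ++ [neg i]).
Proof.
  intros H; apply (eqF_cancel_r [pos i]); rewrite <- app_assoc.
  change (eqF ([neg i] ++ (u ++ [pos i])) (shift u ++ [neg i; pos i])).
  rewrite (eqF_shift _ _ H), (eqF_cancel (neg i)), app_nil_r.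
  change (eqF ([neg i; pos i] ++ shift u) (shift u)).
  now rewrite (eqF_cancel (neg i)).
Qed.

(** ** Fractions of sorted positive words *)

Definition frac (P N : list nat) : word := map pos P ++ map neg (rev N).

Lemma map_neg_inverse N : map neg (rev N) = inverse_word (map pos N).
Proof. unfold inverse_word; now rewrite <- map_rev, map_map. Qed.

Lemma shift_frac P N : shift (frac P N) = frac (map S P) (map S N).
Proof.
  unfold shift, frac; now rewrite map_app, <- map_rev, !map_map.
Qed.

Lemma Forall_frac (Q : nat -> Prop) P N :
  Forall Q P -> Forall Q N -> Forall (fun a => Q (fst a)) (frac P N).
Proof.
  intros HP HN; unfold frac; apply Forall_app; split; apply Forall_map; [easy|].
  now apply Forall_rev.
Qed.

Lemma frac_cons_l i P N : frac (i :: P) N = [pos i] ++ frac P N.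
Proof. reflexivity. Qed.

Lemma frac_cons_r i P N : frac P (i :: N) = frac P N ++ [neg i].
Proof. unfold frac; simpl; now rewrite map_app, app_assoc. Qed.

(** Conjugating by [x_i] removes a pair [x_i], [x_i^{-1}] that encloses letters
    with larger indices, at the price of lowering these indices. *)
Lemma eqF_frac_conj i P N :
  Forall (lt i) P -> Forall (lt i) N ->
  eqF (frac (i :: map S P) (i :: map S N)) (frac P N).
Proof.
  intros HP HN; apply (eqF_cancel_r [pos i]).
  rewrite (eqF_shift i (frac P N)) by now apply (Forall_frac (lt i)).
  rewrite frac_cons_r, <- app_assoc, shift_frac.
  change ([neg i] ++ [pos i]) with [neg i; inv (neg i)].
  rewrite eqF_cancel, app_nil_r; reflexivity.
Qed.

Lemma Sorted_cons_iff i l : Sorted le (i :: l) <-> Sorted le l /\ Forall (le i) l.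
Proof.
  split.
  - intros H; apply Sorted_StronglySorted in H; [|intros ? ? ?; lia].
    apply StronglySorted_inv in H as [H1 H2]; split; auto.
    now apply StronglySorted_Sorted.
  - intros [H1 H2]; constructor; auto.
    destruct H2; constructor; auto.
Qed.

Lemma Sorted_map (f : nat -> nat) l :
  (forall x y, x <= y -> f x <= f y) -> Sorted le l -> Sorted le (map f l).
Proof.
  intros Hf; induction 1 as [|a l H IH Ha]; simpl; constructor; auto.
  destruct Ha; simpl; constructor; auto.
Qed.

(** * Uniqueness of normal forms *)

(** [x_i] acts on the real line by a piecewise linear homeomorphism: the
    identity up to [i], slope 2 from [i] to [i + 1], a translation by 1 beyond. *)
Definition act (a : letter) (t : R) : R :=
  let i := INR (fst a) in
  if Rle_dec t i then t
  else if snd a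
  then if Rle_dec t (i + 1) then (2 * t - i)%R else (t + 1)%R
  else if Rle_dec t (i + 2) then ((t + i) / 2)%R else (t - 1)%R.

Definition act_word (u : word) (t : R) : R := fold_left (fun x a => act a x) u t.

Ltac act_cases :=
  unfold act; simpl fst; simpl snd; simpl negb; cbv zeta iota;
  repeat match goal with |- context [Rle_dec ?x ?y] => destruct (Rle_dec x y) end;
  try lra.

Lemma act_word_eqF u v : eqF u v -> forall t, act_word u t = act_word v t.
Proof.
  induction 1 as [u|u v H IH|u v w H1 IH1 H2 IH2|u u' v v' H1 IH1 H2 IH2|a|u v H];
    intros t.
  - reflexivity.
  - now rewrite IH.
  - now rewrite IH1.
  - unfold act_word in *; rewrite !fold_left_app, IH1; apply IH2.
  - destruct a as [i [|]]; unfold act_word; simpl; act_cases.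
  - destruct H as [i k Hik]; unfold act_word; cbn [fold_left].
    assert (INR i + 1 <= INR k)%R
      by (rewrite <- S_INR; apply le_INR; lia).
    unfold pos, neg; act_cases; rewrite ?S_INR in *; lra.
Qed.

Definition exponent (i : nat) (u : word) : Z :=
  fold_right (fun (a : letter) (e : Z) =>
    if Nat.eqb (fst a) i then (if snd a then e + 1 else e - 1)%Z else e) 0%Z u.

(** Letters of index above [i] fix a neighbourhood of [i], and [x_i] doubles the
    distance to the right of [i]; so the action shows the exponent sum in [x_i]. *)
Lemma act_word_germ i u :
  Forall (fun a => i <= fst a) u ->
  exists d, (0 < d)%R /\ forall e, (0 <= e <= d)%R ->
    act_word u (INR i + e) = (INR i + exp (IZR (exponent i u) * ln 2) * e)%R.
Proof.
  induction 1 as [|[k b] u Ha Hu IH].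
  - exists 1%R; split; [lra|]; intros e _; simpl; rewrite Rmult_0_l, exp_0.
    unfold act_word; simpl; lra.
  - destruct IH as (d & Hd & IH); simpl in Ha.
    unfold act_word in *; simpl.
    destruct (Nat.eqb_spec k i) as [->|Hk].
    + destruct b.
      * exists (Rmin 1 (d / 2)); split; [apply Rmin_glb_lt; lra|]; intros e He.
        pose proof (Rmin_l 1 (d / 2)); pose proof (Rmin_r 1 (d / 2)).
        replace (act (i, true) (INR i + e)) with (INR i + 2 * e)%R by act_cases.
        rewrite IH by lra.
        rewrite plus_IZR, Rmult_plus_distr_r, exp_plus, Rmult_1_l, exp_ln; lra.
      * exists (Rmin 1 d); split; [apply Rmin_glb_lt; lra|]; intros e He.
        pose proof (Rmin_l 1 d); pose proof (Rmin_r 1 d).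
        replace (act (i, false) (INR i + e)) with (INR i + e / 2)%R by act_cases.
        rewrite IH by lra.
        unfold Zminus; rewrite plus_IZR, Rmult_plus_distr_r, exp_plus.
        replace (IZR (- (1)) * ln 2)%R with (- ln 2)%R by (simpl; lra).
        rewrite exp_Ropp, exp_ln; lra.
    + exists (Rmin 1 d); split; [apply Rmin_glb_lt; lra|]; intros e He.
      pose proof (Rmin_l 1 d); pose proof (Rmin_r 1 d).
      assert (INR i + 1 <= INR k)%R
        by (rewrite <- S_INR; apply le_INR; lia).
      replace (act (k, b) (INR i + e)) with (INR i + e)%R by act_cases.
      apply IH; lra.
Qed.

Lemma exponent_eqF i u v :
  Forall (fun a => i <= fst a) u -> Forall (fun a => i <= fst a) v ->
  eqF u v -> exponent i u = exponent i v.
Proof.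
  intros Hu Hv H.
  destruct (act_word_germ i u Hu) as (d & Hd & Eu).
  destruct (act_word_germ i v Hv) as (d' & Hd' & Ev).
  pose proof (Rmin_l d d'); pose proof (Rmin_r d d').
  assert (Hm : (0 < Rmin d d')%R) by now apply Rmin_glb_lt.
  specialize (Eu (Rmin d d') ltac:(lra)); specialize (Ev (Rmin d d') ltac:(lra)).
  rewrite (act_word_eqF _ _ H), Ev in Eu.
  apply Rplus_eq_reg_l, Rmult_eq_reg_r, exp_inv, Rmult_eq_reg_r, eq_IZR in Eu;
    [easy| |lra].
  pose proof (ln_lt_2); lra.
Qed.

Lemma exponent_frac i P N :
  exponent i (frac P N) =
  (Z.of_nat (count_occ Nat.eq_dec P i) - Z.of_nat (count_occ Nat.eq_dec N i))%Z.
Proof.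
  assert (A : forall u v, exponent i (u ++ v) = (exponent i u + exponent i v)%Z).
  { intros u v; induction u as [|[k [|]] u IH]; simpl; [easy| |];
      destruct (Nat.eqb k i); lia. }
  induction N as [|k N IH].
  - unfold frac; simpl; rewrite app_nil_r.
    induction P as [|k P IH]; [easy|]; simpl in *; rewrite IH.
    destruct (Nat.eqb_spec k i), (Nat.eq_dec k i); try easy; lia.
  - rewrite frac_cons_r, A, IH; simpl.
    destruct (Nat.eqb_spec k i), (Nat.eq_dec k i); try easy; lia.
Qed.

Definition reduced (P N : list nat) : Prop :=
  forall i, In i P -> In i N -> In (S i) P \/ In (S i) N.

Lemma reduced_NF2 P N : reduced P N <-> NF2 (frac P N).
Proof.
  assert (HP : forall i, In (pos i) (frac P N) <-> In i P).
  { intros i; unfold frac; rewrite in_app_iff, !in_map_iff; split.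
    - intros [(x & E & H)|(x & E & H)]; [now injection E as ->|easy].
    - eauto. }
  assert (HN : forall i, In (neg i) (frac P N) <-> In i N).
  { intros i; unfold frac; rewrite in_app_iff, !in_map_iff; split.
    - intros [(x & E & H)|(x & E & H)]; [easy|injection E as ->].
      now apply in_rev.
    - intros H; right; exists i; split; [easy|]; now apply in_rev in H. }
  unfold reduced, NF2; split; intros H i; specialize (H i);
    rewrite ?HP, ?HN in *; auto.
Qed.

Lemma reduced_tail_l i P N :
  Forall (le i) P -> Forall (le i) N -> reduced (i :: P) N -> reduced P N.
Proof.
  rewrite !Forall_forall; intros HP HN H j Hj Hj'.
  destruct (H j) as [[E|E]|E]; simpl; auto.
  apply HP in Hj; lia.
Qed.

Lemma reduced_tail_r i P N :
  Forall (le i) P -> Forall (le i) N -> reduced P (i :: N) -> reduced P N.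
Proof.
  rewrite !Forall_forall; intros HP HN H j Hj Hj'.
  destruct (H j) as [E|[E|E]]; simpl; auto.
  apply HP in Hj; lia.
Qed.

Lemma reduced_map_S P N : reduced P N -> reduced (map S P) (map S N).
Proof.
  intros H i; rewrite !in_map_iff; intros (x & <- & Hx) (y & E & Hy).
  injection E as ->; destruct (H x Hx Hy); eauto.
Qed.

Lemma head_min i l :
  Sorted le l -> Forall (le i) l ->
  (exists l', l = i :: l' /\ Sorted le l' /\ Forall (le i) l') \/ Forall (lt i) l.
Proof.
  destruct l as [|a l]; [auto|]; rewrite Sorted_cons_iff, Forall_cons_iff.
  intros (Hs & Hl) (Ha & Hi).
  destruct (Nat.eq_dec a i) as [->|]; [left; eauto|right].
  constructor; [lia|]; revert Hl; apply Forall_impl; lia.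
Qed.

Lemma count_occ_lt i l : Forall (lt i) l -> count_occ Nat.eq_dec l i = 0.
Proof.
  intros H; apply count_occ_not_In; rewrite Forall_forall in H.
  intros Hi; apply H in Hi; lia.
Qed.

Lemma Forall_le_lt i l : Forall (lt i) l -> Forall (le i) l.
Proof. apply Forall_impl; lia. Qed.

Lemma exists_min i P N P' N' :
  In i (P ++ N ++ P' ++ N') ->
  exists j, In j (P ++ N ++ P' ++ N') /\ Forall (le j) P /\ Forall (le j) N /\
    Forall (le j) P' /\ Forall (le j) N'.
Proof.
  assert (M : forall l, In i l -> exists j, In j l /\ Forall (le j) l).
  { clear; intros l H; assert (Hl : l <> []) by (intros ->; easy); clear H.
    induction l as [|a l IH]; [easy|].
    destruct l as [|b l]; [exists a; simpl; auto|].
    destruct IH as (j & Hj & F); [easy|].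
    destruct (le_lt_dec a j).
    - exists a; split; [now left|]; constructor; [auto|].
      revert F; apply Forall_impl; lia.
    - exists j; split; [now right|]; constructor; [lia|auto]. }
  intros H; destruct (M _ H) as (j & Hj & F); exists j.
  rewrite !Forall_app in F; tauto.
Qed.

(** By induction on the total length. At the least index [i] the exponent sums
    agree, so either both fractions start with [x_i], or both end with
    [x_i^{-1}], and this letter is cancelled, or exactly one of them has letters
    [x_i^{+-1}], in a pair, which is impossible. *)
Lemma frac_unique P N P' N' :
  Sorted le P -> Sorted le N -> Sorted le P' -> Sorted le N' ->
  reduced P N -> reduced P' N' -> eqF (frac P N) (frac P' N') ->
  P = P' /\ N = N'.
Proof.
  remember (length P + length N + length P' + length N') as n eqn:En.
  revert P N P' N' En; induction n as [n IHn] using lt_wf_ind.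
  intros P N P' N' -> SP SN SP' SN' HR HR' HE.
  assert (IH : forall p n p' n',
    length p + length n + length p' + length n' <
      length P + length N + length P' + length N' ->
    Sorted le p -> Sorted le n -> Sorted le p' -> Sorted le n' ->
    reduced p n -> reduced p' n' -> eqF (frac p n) (frac p' n') ->
    p = p' /\ n = n') by (intros; now apply (IHn _ ltac:(eassumption))).
  clear IHn.
  destruct (P ++ N ++ P' ++ N') as [|i0 l0] eqn:E0.
  { apply app_eq_nil in E0 as [-> E0]; apply app_eq_nil in E0 as [-> E0].
    apply app_eq_nil in E0 as [-> ->]; auto. }
  destruct (exists_min i0 P N P' N') as (i & Hi & LP & LN & LP' & LN');
    [rewrite E0; now left|clear E0 i0 l0].
  assert (HX : exponent i (frac P N) = exponent i (frac P' N'))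
    by (apply exponent_eqF; auto; now apply (Forall_frac (le i))).
  rewrite !exponent_frac in HX.
  rewrite !in_app_iff in Hi.
  assert (nlt : forall l, Forall (lt i) l -> ~ In i l)
    by (intros l F HI; rewrite Forall_forall in F; apply F in HI; lia).
  pose proof count_occ_lt as C0.
  assert (PAIR : forall p n p' n',
    length p + length n + length p' + length n' <
      length P + length N + length P' + length N' ->
    Sorted le p -> Sorted le n -> Forall (le i) p -> Forall (le i) n ->
    Sorted le p' -> Sorted le n' -> Forall (lt i) p' -> Forall (lt i) n' ->
    reduced (i :: p) (i :: n) -> reduced p' n' ->
    ~ eqF (frac (i :: p) (i :: n)) (frac p' n')).
  { intros p n p' n' HL Sp Sn Lp Ln Sp' Sn' Gp' Gn' Hr Hr' HE'.
    assert (p = map S p' /\ n = map S n') as [-> ->].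
    { apply IH; auto using Sorted_map, le_n_S, reduced_map_S.
      - now rewrite !length_map.
      - apply (reduced_tail_l i), (reduced_tail_r i); auto.
      - apply (eqF_cancel_l [pos i]), (eqF_cancel_r [neg i]).
        rewrite <- !frac_cons_l, <- !frac_cons_r, HE'.
        symmetry; now apply eqF_frac_conj. }
    (* Conjugation has left no letter of index [i + 1]. *)
    rewrite Forall_forall in Gp', Gn'.
    destruct (Hr i) as [[E|E]|[E|E]]; try (now left); try lia;
      apply in_map_iff in E as (x & E & Hx); injection E as ->.
    - apply Gp' in Hx; lia.
    - apply Gn' in Hx; lia. }
  destruct (head_min i P SP LP) as [(P1 & -> & SP1 & LP1)|GP];
  destruct (head_min i P' SP' LP') as [(P1' & -> & SP1' & LP1')|GP'].
  - assert (P1 = P1' /\ N = N') as [-> ->]; auto.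
    apply IH; eauto using reduced_tail_l; [simpl; lia|].
    now apply (eqF_cancel_l [pos i]).
  - rewrite (C0 _ _ GP'), count_occ_cons_eq in HX by easy.
    destruct (head_min i N SN LN) as [(N1 & -> & SN1 & LN1)|GN];
      [|rewrite (C0 _ _ GN) in HX; lia].
    destruct (head_min i N' SN' LN') as [(N1' & -> & SN1' & LN1')|GN'].
    + assert (i :: P1 = P' /\ N1 = N1') as [-> ->]; auto.
      apply IH; eauto using reduced_tail_r, Forall_le_lt; [simpl; lia|].
      rewrite !frac_cons_r in HE; eapply eqF_cancel_r; eauto.
    + exfalso; apply (PAIR P1 N1 P' N'); auto; simpl; lia.
  - rewrite (C0 _ _ GP), count_occ_cons_eq in HX by easy.
    destruct (head_min i N' SN' LN') as [(N1' & -> & SN1' & LN1')|GN'];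
      [|rewrite (C0 _ _ GN') in HX; lia].
    destruct (head_min i N SN LN) as [(N1 & -> & SN1 & LN1)|GN].
    + assert (P = i :: P1' /\ N1 = N1') as [-> ->]; auto.
      apply IH; eauto using reduced_tail_r, Forall_le_lt; [simpl; lia|].
      rewrite !frac_cons_r in HE; eapply eqF_cancel_r; eauto.
    + exfalso; apply (PAIR P1' N1' P N); auto; [simpl; lia|].
      now symmetry.
  - rewrite (C0 _ _ GP), (C0 _ _ GP') in HX.
    destruct (head_min i N SN LN) as [(N1 & -> & SN1 & LN1)|GN];
    destruct (head_min i N' SN' LN') as [(N1' & -> & SN1' & LN1')|GN'].
    + assert (P = P' /\ N1 = N1') as [-> ->]; auto.
      apply IH; eauto using reduced_tail_r, Forall_le_lt; [simpl; lia|].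
      rewrite !frac_cons_r in HE; eapply eqF_cancel_r; eauto.
    + rewrite (C0 _ _ GN'), count_occ_cons_eq in HX by easy; lia.
    + rewrite (C0 _ _ GN), count_occ_cons_eq in HX by easy; lia.
    + exfalso; destruct Hi as [Hi|[Hi|[Hi|Hi]]]; revert Hi; now apply nlt.
Qed.

Lemma is_normal_form_frac w P N :
  Sorted le P -> Sorted le N -> reduced P N -> eqF w (frac P N) ->
  is_normal_form_of w (frac P N).
Proof.
  intros SP SN HR HE; split.
  - repeat split; [auto|exists P, N; auto|now apply reduced_NF2].
  - intros v (Ev & (P' & N' & -> & SP' & SN') & HR').
    apply (proj2 (reduced_NF2 P' N')) in HR'.
    destruct (frac_unique P N P' N') as [-> ->]; auto.
    now rewrite <- HE.
Qed.

(** * Merging in linear time *)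

Definition raise (c : nat) (l : list nat) : list nat := map (Nat.add c) l.

Lemma raise_0 l : raise 0 l = l.
Proof. apply map_id. Qed.

Lemma raise_S c l : map S (raise c l) = raise (S c) l.
Proof. unfold raise; now rewrite map_map. Qed.

Lemma Forall_le_raise i c a l :
  i <= c + a -> Forall (le a) l -> Forall (le i) (raise c l).
Proof.
  intros Hi H; apply Forall_map; revert H; apply Forall_impl; lia.
Qed.

Lemma Forall_lt_raise i c a l :
  i < c + a -> Sorted le (a :: l) -> Forall (lt i) (raise c (a :: l)).
Proof.
  rewrite Sorted_cons_iff; intros Hi [_ H]; constructor; [easy|].
  apply Forall_map; revert H; apply Forall_impl; lia.
Qed.

Lemma shift_map_pos l : shift (map pos l) = map pos (map S l).
Proof. unfold shift; now rewrite !map_map. Qed.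

Lemma shift_map_neg l : shift (map neg l) = map neg (map S l).
Proof. unfold shift; now rewrite !map_map. Qed.

(** The sorted form of the positive word [raise c A ++ B]. A letter of [B]
    that is smaller than the first letter of [A] passes to the left of all of
    [A] and raises it; the raising is deferred to the offset [c], so that each
    letter is touched only once. *)
Fixpoint merge (A : list nat) : nat -> list nat -> list nat :=
  fix merge_A c B :=
    match A, B with
    | [], _ => B
    | a :: A', [] => c + a :: merge A' c []
    | a :: A', b :: B' =>
        if b <? c + a then b :: merge_A (S c) B' else c + a :: merge A' c B
    end.

Lemma merge_nil_l c B : merge [] c B = B.
Proof. now destruct B. Qed.

Lemma merge_cons_nil a A c : merge (a :: A) c [] = c + a :: merge A c [].
Proof. reflexivity. Qed.

Lemma merge_cons_cons a A c b B :
  merge (a :: A) c (b :: B) =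
  if b <? c + a then b :: merge (a :: A) (S c) B else c + a :: merge A c (b :: B).
Proof. reflexivity. Qed.

Lemma merge_lower_bound i A c B :
  Forall (le i) (raise c A) -> Forall (le i) B -> Forall (le i) (merge A c B).
Proof.
  revert c B; induction A as [|a A IHA]; intros c B HA HB.
  - now rewrite merge_nil_l.
  - revert c HA; induction B as [|b B IHB]; intros c HA;
      apply Forall_cons_iff in HA as HA'; destruct HA' as [Ha HA'].
    + rewrite merge_cons_nil; auto.
    + apply Forall_cons_iff in HB as HB'; destruct HB' as [Hb HB'].
      rewrite merge_cons_cons; destruct (Nat.ltb_spec b (c + a)); constructor; auto.
      apply IHB; auto.
      rewrite <- raise_S; apply Forall_map; revert HA; apply Forall_impl; lia.
Qed.

Lemma merge_sorted A c B :
  Sorted le A -> Sorted le B -> Sorted le (merge A c B).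
Proof.
  revert c B; induction A as [|a A IHA]; intros c B HA HB.
  - now rewrite merge_nil_l.
  - apply Sorted_cons_iff in HA as HA'; destruct HA' as [HA' Ha].
    revert c; induction B as [|b B IHB]; intros c.
    + rewrite merge_cons_nil; apply Sorted_cons_iff; split; auto.
      apply merge_lower_bound; auto; apply (Forall_le_raise _ _ a); auto.
    + apply Sorted_cons_iff in HB as HB'; destruct HB' as [HB' Hb].
      rewrite merge_cons_cons; destruct (Nat.ltb_spec b (c + a));
        apply Sorted_cons_iff; (split; [now auto|]); apply merge_lower_bound;
        auto.
      * apply Forall_le_lt, Forall_lt_raise; auto; lia.
      * now apply (Forall_le_raise _ _ a).
      * constructor; [lia|]; revert Hb; apply Forall_impl; lia.
Qed.

Lemma merge_length A c B : length (merge A c B) = length A + length B.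
Proof.
  revert c B; induction A as [|a A IHA]; intros c B.
  - now rewrite merge_nil_l.
  - revert c; induction B as [|b B IHB]; intros c.
    + rewrite merge_cons_nil; simpl; now rewrite IHA.
    + rewrite merge_cons_cons; destruct (b <? c + a); simpl.
      * rewrite IHB; simpl; lia.
      * now rewrite IHA.
Qed.

Lemma merge_eqF A c B :
  Sorted le A -> Sorted le B ->
  eqF (map pos (raise c A) ++ map pos B) (map pos (merge A c B)).
Proof.
  revert c B; induction A as [|a A IHA]; intros c B HA HB.
  - now rewrite merge_nil_l.
  - apply Sorted_cons_iff in HA as HA'; destruct HA' as [HA' Ha].
    revert c; induction B as [|b B IHB]; intros c.
    + rewrite merge_cons_nil.
      change (eqF ([pos (c + a)] ++ (map pos (raise c A) ++ map pos []))
                  ([pos (c + a)] ++ map pos (merge A c []))).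
      now rewrite IHA.
    + apply Sorted_cons_iff in HB as HB'; destruct HB' as [HB' Hb].
      rewrite merge_cons_cons; destruct (Nat.ltb_spec b (c + a)).
      * change (map pos (b :: B)) with ([pos b] ++ map pos B).
        rewrite app_assoc, (eqF_shift b).
        -- rewrite shift_map_pos, raise_S; simpl app.
           change (eqF ([pos b] ++ (map pos (raise (S c) (a :: A)) ++ map pos B))
             ([pos b] ++ map pos (merge (a :: A) (S c) B))).
           now rewrite IHB.
        -- apply Forall_map; simpl; now apply Forall_lt_raise.
      * change (eqF ([pos (c + a)] ++ (map pos (raise c A) ++ map pos (b :: B)))
                    ([pos (c + a)] ++ map pos (merge A c (b :: B)))).
        now rewrite IHA.
Qed.

(** The fraction that equals the inverse of [raise c A] followed by
    [raise d B]. Of the two adjacent letters the smaller one passes over the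
    whole opposite word and raises it; equal letters cancel. *)
Fixpoint cancel (A : list nat) : nat -> nat -> list nat -> list nat * list nat :=
  fix cancel_A c d B :=
    match A, B with
    | [], _ => (raise d B, [])
    | a :: A', [] => let r := cancel A' c d [] in (fst r, c + a :: snd r)
    | a :: A', b :: B' =>
        if c + a =? d + b then cancel A' c d B'
        else if c + a <? d + b
        then let r := cancel A' c (S d) B in (fst r, c + a :: snd r)
        else let r := cancel_A (S c) d B' in (d + b :: fst r, snd r)
    end.

Lemma cancel_nil_l c d B : cancel [] c d B = (raise d B, []).
Proof. now destruct B. Qed.

Lemma cancel_cons_nil a A c d :
  cancel (a :: A) c d [] =
  (fst (cancel A c d []), c + a :: snd (cancel A c d [])).
Proof. reflexivity. Qed.

Lemma cancel_cons_cons a A c d b B :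
  cancel (a :: A) c d (b :: B) =
  if c + a =? d + b then cancel A c d B
  else if c + a <? d + b
  then (fst (cancel A c (S d) (b :: B)), c + a :: snd (cancel A c (S d) (b :: B)))
  else (d + b :: fst (cancel (a :: A) (S c) d B), snd (cancel (a :: A) (S c) d B)).
Proof. reflexivity. Qed.

Lemma cancel_lower_bound i j A c d B :
  Forall (le i) (raise c A) -> Forall (le j) (raise d B) ->
  Forall (le j) (fst (cancel A c d B)) /\ Forall (le i) (snd (cancel A c d B)).
Proof.
  assert (R : forall i c l, Forall (le i) (raise c l) ->
    Forall (le i) (raise (S c) l)).
  { intros k e l H; rewrite <- raise_S; apply Forall_map; revert H.
    apply Forall_impl; lia. }
  revert c d B; induction A as [|a A IHA]; intros c d B HA HB.
  - rewrite cancel_nil_l; simpl; auto.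
  - revert c HA; induction B as [|b B IHB]; intros c HA;
      apply Forall_cons_iff in HA as HA'; destruct HA' as [Ha HA'].
    + rewrite cancel_cons_nil; destruct (IHA c d []); simpl; auto.
    + apply Forall_cons_iff in HB as HB'; destruct HB' as [Hb HB'].
      rewrite cancel_cons_cons; destruct (c + a =? d + b); [now apply IHA|].
      destruct (c + a <? d + b).
      * destruct (IHA c (S d) (b :: B)); auto; simpl; auto.
      * destruct (IHB HB' (S c)); auto; simpl; auto.
Qed.

Lemma cancel_sorted A c d B :
  Sorted le A -> Sorted le B ->
  Sorted le (fst (cancel A c d B)) /\ Sorted le (snd (cancel A c d B)).
Proof.
  revert c d B; induction A as [|a A IHA]; intros c d B HA HB.
  - rewrite cancel_nil_l; split; [|constructor].
    apply Sorted_map; auto; lia.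
  - apply Sorted_cons_iff in HA as HA'; destruct HA' as [HA' Ha].
    revert c; induction B as [|b B IHB]; intros c.
    + rewrite cancel_cons_nil; destruct (IHA c d []) as [H1 H2]; auto; split; auto; simpl.
      apply Sorted_cons_iff; split; auto.
      apply (cancel_lower_bound _ 0); [|constructor].
      now apply (Forall_le_raise _ _ a).
    + apply Sorted_cons_iff in HB as HB'; destruct HB' as [HB' Hb].
      rewrite cancel_cons_cons; destruct (Nat.eqb_spec (c + a) (d + b)); [now apply IHA|].
      destruct (Nat.ltb_spec (c + a) (d + b)); simpl.
      * destruct (IHA c (S d) (b :: B)); auto; split; auto.
        apply Sorted_cons_iff; split; auto.
        apply (cancel_lower_bound _ 0); [now apply (Forall_le_raise _ _ a)|].
        apply Forall_forall; lia.
      * destruct (IHB HB' (S c)); split; auto.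
        apply Sorted_cons_iff; split; auto.
        apply (cancel_lower_bound 0 _ (a :: A)); [apply Forall_forall; lia|].
        now apply (Forall_le_raise _ _ b).
Qed.

Lemma cancel_length A c d B :
  length (fst (cancel A c d B)) <= length B /\
  length (snd (cancel A c d B)) <= length A.
Proof.
  revert c d B; induction A as [|a A IHA]; intros c d B.
  - rewrite cancel_nil_l; simpl; unfold raise; rewrite length_map; lia.
  - revert c; induction B as [|b B IHB]; intros c.
    + rewrite cancel_cons_nil; specialize (IHA c d []); simpl in *; lia.
    + rewrite cancel_cons_cons; destruct (c + a =? d + b).
      * specialize (IHA c d B); simpl in *; lia.
      * destruct (c + a <? d + b); cbn [fst snd length].
        -- specialize (IHA c (S d) (b :: B)); simpl in *; lia.
        -- specialize (IHB (S c)); cbn [length] in IHB; lia.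
Qed.

Lemma cancel_eqF A c d B :
  Sorted le A -> Sorted le B ->
  eqF (map neg (rev (raise c A)) ++ map pos (raise d B))
      (frac (fst (cancel A c d B)) (snd (cancel A c d B))).
Proof.
  revert c d B; induction A as [|a A IHA]; intros c d B HA HB.
  - rewrite cancel_nil_l; unfold frac; simpl; now rewrite app_nil_r.
  - apply Sorted_cons_iff in HA as HA'; destruct HA' as [HA' Ha].
    assert (EA : forall c, map neg (rev (raise c (a :: A))) =
                   map neg (rev (raise c A)) ++ [neg (c + a)])
      by (intros e; simpl; now rewrite map_app).
    revert c; induction B as [|b B IHB]; intros c.
    + specialize (IHA c d [] HA' HB); simpl in IHA; rewrite app_nil_r in IHA.
      rewrite EA, cancel_cons_nil; cbn [fst snd].
      rewrite frac_cons_r, <- IHA; simpl; now rewrite app_nil_r.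
    + apply Sorted_cons_iff in HB as HB'; destruct HB' as [HB' Hb].
      assert (EB : map pos (raise d (b :: B)) =
                [pos (d + b)] ++ map pos (raise d B)) by reflexivity.
      rewrite cancel_cons_cons; destruct (Nat.eqb_spec (c + a) (d + b)) as [E|E].
      * rewrite EA, EB, E, <- app_assoc, (app_assoc [neg _]).
        change ([neg (d + b)] ++ [pos (d + b)])
          with [neg (d + b); inv (neg (d + b))].
        rewrite eqF_cancel; now apply IHA.
      * destruct (Nat.ltb_spec (c + a) (d + b)); cbn [fst snd].
        -- rewrite EA, frac_cons_r, <- IHA, <- !app_assoc by auto.
           change ([neg (c + a)] ++ map pos (raise d (b :: B)))
             with (neg (c + a) :: map pos (raise d (b :: B))).
           rewrite eqF_shift_neg.
           ++ now rewrite shift_map_pos, raise_S.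
           ++ apply Forall_map; simpl; apply Forall_lt_raise; auto.
        -- rewrite frac_cons_l, <- (IHB HB' (S c)), EB, app_assoc, (eqF_shift (d + b)).
           ++ rewrite shift_map_neg, map_rev, raise_S; reflexivity.
           ++ apply Forall_map, Forall_rev; simpl; apply Forall_lt_raise; auto; lia.
Qed.

(** Numerator and denominator of a fraction. *)
Definition block : Type := (list nat * list nat)%type.

Definition value (x : block) : word := frac (fst x) (snd x).

Definition sorted_block (x : block) : Prop :=
  Sorted le (fst x) /\ Sorted le (snd x).

Definition size (x : block) : nat := length (fst x) + length (snd x).

(** The inner factors [(snd x)^{-1}] and [fst y] are turned into a fraction,
    whose two halves are then merged with the outer factors. *)
Definition mul (x y : block) : block :=
  let r := cancel (snd x) 0 0 (fst y) in
  (merge (fst x) 0 (fst r), merge (snd y) 0 (snd r)).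

Lemma mul_sorted x y :
  sorted_block x -> sorted_block y -> sorted_block (mul x y).
Proof.
  intros [Px Nx] [Py Ny]; destruct (cancel_sorted (snd x) 0 0 (fst y)); auto.
  split; now apply merge_sorted.
Qed.

Lemma mul_size x y : size (mul x y) <= size x + size y.
Proof.
  unfold size, mul; simpl; rewrite !merge_length.
  pose proof (cancel_length (snd x) 0 0 (fst y)); lia.
Qed.

Lemma mul_eqF x y :
  sorted_block x -> sorted_block y -> eqF (value (mul x y)) (value x ++ value y).
Proof.
  intros [Px Nx] [Py Ny]; destruct (cancel_sorted (snd x) 0 0 (fst y)); auto.
  pose proof (cancel_eqF (snd x) 0 0 (fst y) Nx Py) as E.
  rewrite !raise_0 in E; unfold value, mul; cbv zeta; cbn [fst snd].
  remember (cancel (snd x) 0 0 (fst y)) as r; unfold frac in *.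
  assert (E1 := merge_eqF (fst x) 0 (fst r) ltac:(auto) ltac:(auto)).
  assert (E2 := merge_eqF (snd y) 0 (snd r) ltac:(auto) ltac:(auto)).
  rewrite raise_0 in E1, E2.
  apply eqF_inverse_word in E2; rewrite inverse_word_app in E2.
  rewrite <- !map_neg_inverse in E2.
  rewrite <- E1, <- E2, <- !app_assoc, (app_assoc (map neg (rev (snd x)))), E.
  now rewrite <- app_assoc.
Qed.

(** * Removing pairs in linear time *)

Definition lower (d : nat) (l : list nat) : list nat := map (fun x => x - d) l.

Definition within (m : nat) (l : list nat) : bool :=
  match l with [] => false | r :: _ => r <=? m end.

(** [P] and [N] list the letters that are still to be treated, in decreasing
    order; [lower d RP] and [lower d RN] are the treated ones, in increasing
    order. A pair [x_i], [x_i^{-1}] is removed if no treated letter has index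
    [i + 1] or less, and this lowers all treated letters, which is deferred to
    the offset [d]. *)
Fixpoint reduce (P : list nat) :
    list nat -> nat -> list nat -> list nat -> nat * list nat * list nat :=
  fix reduce_P N d RP RN :=
    match P, N with
    | [], [] => (d, RP, RN)
    | [], n :: N' => reduce_P N' d RP (d + n :: RN)
    | p :: P', [] => reduce P' [] d (d + p :: RP) RN
    | p :: P', n :: N' =>
        if n <? p then reduce P' N d (d + p :: RP) RN
        else if p <? n then reduce_P N' d RP (d + n :: RN)
        else if within (S (d + p)) RP || within (S (d + p)) RN
        then reduce P' N' d (d + p :: RP) (d + n :: RN)
        else reduce P' N' (S d) RP RN
    end.

(** The treated letters form a reduced fraction, and remain one whichever
    untreated letters of a single sign join them. *)
Definition partly_reduced (P N QP QN : list nat) : Prop :=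
  forall i,
    In i QP /\ In i (N ++ QN) \/ In i (P ++ QP) /\ In i QN ->
    In (S i) QP \/ In (S i) QN.

Record pending (P N : list nat) (d : nat) (RP RN : list nat) : Prop := {
  pending_sorted_P : Sorted le (rev P ++ lower d RP);
  pending_sorted_N : Sorted le (rev N ++ lower d RN);
  pending_bound_P : Forall (le d) RP;
  pending_bound_N : Forall (le d) RN;
  pending_reduced : partly_reduced P N (lower d RP) (lower d RN) }.

Lemma pending_swap P N d RP RN :
  pending P N d RP RN -> pending N P d RN RP.
Proof. intros []; constructor; auto; intros i H; destruct (pending_reduced0 i); tauto. Qed.

Lemma lower_cons d p R : lower d (d + p :: R) = p :: lower d R.
Proof. unfold lower; simpl; f_equal; lia. Qed.

Lemma rev_cons_lower p P d R :
  rev (p :: P) ++ lower d R = rev P ++ lower d (d + p :: R).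
Proof. rewrite lower_cons; simpl; now rewrite <- app_assoc. Qed.

Lemma Sorted_middle p A B :
  Sorted le (A ++ p :: B) ->
  (forall x, In x A -> x <= p) /\ (forall x, In x B -> p <= x).
Proof.
  induction A as [|a A IH]; simpl; rewrite Sorted_cons_iff, Forall_forall.
  - intros [_ H]; split; [easy|auto].
  - intros [H Ha]; destruct (IH H) as [H1 H2]; split; auto.
    intros x [->|Hx]; auto.
    apply Ha, in_app_iff; right; now left.
Qed.

Lemma pending_le_P p P N d RP RN :
  pending (p :: P) N d RP RN ->
  (forall x, In x P -> x <= p) /\ (forall x, In x (lower d RP) -> p <= x).
Proof.
  intros [H _ _ _ _]; rewrite rev_cons_lower, lower_cons in H.
  apply Sorted_middle in H as [H1 H2]; split; auto.
  intros x Hx; apply H1; now apply in_rev in Hx.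
Qed.

Lemma pending_move_P p P N d RP RN :
  pending (p :: P) N d RP RN -> ~ In p N -> pending P N d (d + p :: RP) RN.
Proof.
  intros [H1 H2 H3 H4 H5] Hp; constructor; auto.
  - now rewrite <- rev_cons_lower.
  - constructor; [lia|auto].
  - rewrite lower_cons; intros i Hi; specialize (H5 i); simpl in *.
    rewrite !in_app_iff in *; simpl in *.
    destruct Hi as [[[->|Hi] Hi']|Hi]; [|tauto..].
    destruct Hi' as [Hi'|Hi']; [easy|tauto].
Qed.

Lemma within_lower p d R :
  Forall (le d) R -> (forall x, In x (lower d R) -> p <= x) ->
  within (S (d + p)) R = true -> In p (lower d R) \/ In (S p) (lower d R).
Proof.
  destruct R as [|r R]; [easy|]; simpl; intros HR Hx.
  apply Forall_cons_iff in HR as [Hr _].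
  rewrite Nat.leb_le; intros H; specialize (Hx (r - d) (or_introl eq_refl)); lia.
Qed.

(** The treated letter that blocks the removal has index [p + 1], as desired, or
    [p]. In the latter case it already had an untreated partner of the opposite
    sign, and the invariant says that [p + 1] occurs. *)
Lemma pending_move_pair p P N d RP RN :
  pending (p :: P) (p :: N) d RP RN ->
  within (S (d + p)) RP || within (S (d + p)) RN = true ->
  pending P N d (d + p :: RP) (d + p :: RN).
Proof.
  intros H HW.
  pose proof (proj2 (pending_le_P _ _ _ _ _ _ H)) as LP.
  pose proof (proj2 (pending_le_P _ _ _ _ _ _ (pending_swap _ _ _ _ _ H))) as LN.
  destruct H as [H1 H2 H3 H4 H5].
  assert (HS : In (S p) (lower d RP) \/ In (S p) (lower d RN)).
  { apply orb_prop in HW as [HW|HW]; apply within_lower in HW; auto;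
      destruct HW as [HW|HW]; auto; apply (H5 p);
      rewrite !in_app_iff; simpl; tauto. }
  constructor; rewrite <- ?rev_cons_lower; auto; [constructor; [lia|auto]..|].
  rewrite !lower_cons; intros i Hi; specialize (H5 i); simpl in *.
  destruct (Nat.eq_dec p i) as [->|Hpi]; [tauto|].
  rewrite !in_app_iff in *; simpl in *; tauto.
Qed.

Lemma not_within_lower p d R :
  Sorted le (lower d R) -> within (S (d + p)) R = false ->
  Forall (lt (S p)) (lower d R).
Proof.
  destruct R as [|r R]; [constructor|]; simpl; rewrite Nat.leb_gt.
  rewrite Sorted_cons_iff; intros [_ H] Hr; constructor; [lia|].
  revert H; apply Forall_impl; lia.
Qed.

Lemma lower_S d R : lower (S d) R = map pred (lower d R).
Proof.
  unfold lower; rewrite map_map; apply map_ext; lia.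
Qed.

Lemma map_S_pred l : Forall (lt 0) l -> map S (map pred l) = l.
Proof.
  induction 1; simpl; f_equal; auto; lia.
Qed.

Lemma Sorted_app_r A B : Sorted le (A ++ B) -> Sorted le B.
Proof. induction A; simpl; auto; rewrite Sorted_cons_iff; tauto. Qed.

Lemma Sorted_app_l A B : Sorted le (A ++ B) -> Sorted le A.
Proof.
  induction A; simpl; [constructor|].
  rewrite !Sorted_cons_iff, Forall_app; tauto.
Qed.

Lemma Sorted_app_intro A B :
  Sorted le A -> Sorted le B -> (forall x y, In x A -> In y B -> x <= y) ->
  Sorted le (A ++ B).
Proof.
  intros HA HB H; induction A as [|a A IH]; simpl; auto.
  apply Sorted_cons_iff in HA as [HA Ha]; apply Sorted_cons_iff; split.
  - apply IH; auto; intros x y Hx; apply H; now right.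
  - apply Forall_app; split; auto; apply Forall_forall; intros y Hy.
    apply H; auto; now left.
Qed.

Lemma Sorted_remove p P d R :
  Sorted le (rev (p :: P) ++ lower d R) -> Forall (lt (S p)) (lower d R) ->
  Sorted le (rev P ++ lower (S d) R).
Proof.
  rewrite rev_cons_lower, lower_cons, lower_S; intros H HR.
  pose proof (Sorted_middle _ _ _ H) as [HP _].
  apply Sorted_app_intro.
  - eapply Sorted_app_l; eauto.
  - apply Sorted_map; [lia|].
    now apply Sorted_app_r, Sorted_cons_iff in H.
  - intros x y Hx Hy; apply HP in Hx.
    apply in_map_iff in Hy as (z & <- & Hz).
    rewrite Forall_forall in HR; apply HR in Hz; lia.
Qed.

Lemma Forall_le_lower p d R :
  Forall (le d) R -> Forall (lt (S p)) (lower d R) -> Forall (le (S d)) R.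
Proof.
  unfold lower; rewrite Forall_map, !Forall_forall.
  intros H H' x Hx; specialize (H x Hx); specialize (H' x Hx); lia.
Qed.

Lemma pending_remove p P N d RP RN :
  pending (p :: P) (p :: N) d RP RN ->
  Forall (lt (S p)) (lower d RP) -> Forall (lt (S p)) (lower d RN) ->
  pending P N (S d) RP RN.
Proof.
  intros H HP HN.
  pose proof (proj1 (pending_le_P _ _ _ _ _ _ H)) as LP.
  pose proof (proj1 (pending_le_P _ _ _ _ _ _ (pending_swap _ _ _ _ _ H))) as LN.
  destruct H as [H1 H2 H3 H4 H5]; constructor;
    eauto using Sorted_remove, Forall_le_lower.
  rewrite !lower_S; intros i Hi; specialize (H5 (S i)).
  rewrite Forall_forall in HP, HN.
  assert (EP : In i (map pred (lower d RP)) <-> In (S i) (lower d RP) /\ p < i).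
  { rewrite in_map_iff; split.
    - intros (x & <- & Hx); apply HP in Hx as Hx'.
      rewrite Nat.succ_pred by lia; split; [easy|lia].
    - intros [Hx _]; now exists (S i). }
  assert (EN : In i (map pred (lower d RN)) <-> In (S i) (lower d RN) /\ p < i).
  { rewrite in_map_iff; split.
    - intros (x & <- & Hx); apply HN in Hx as Hx'.
      rewrite Nat.succ_pred by lia; split; [easy|lia].
    - intros [Hx _]; now exists (S i). }
  assert (LP' : In i P -> ~ p < i) by (intros Hx; apply LP in Hx; lia).
  assert (LN' : In i N -> ~ p < i) by (intros Hx; apply LN in Hx; lia).
  rewrite !in_app_iff in *.
  destruct H5 as [H5|H5].
  - rewrite EP, EN in Hi; tauto.
  - left; change (S i) with (pred (S (S i))); now apply in_map.
  - right; change (S i) with (pred (S (S i))); now apply in_map.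
Qed.

Lemma remove_pair_eqF p P N QP QN :
  Forall (lt (S p)) QP -> Forall (lt (S p)) QN ->
  eqF (frac (rev (p :: P) ++ QP) (rev (p :: N) ++ QN))
      (frac (rev P ++ map pred QP) (rev N ++ map pred QN)).
Proof.
  intros HP HN.
  assert (A : forall A B C D,
    frac (A ++ B) (C ++ D) = map pos A ++ frac B D ++ map neg (rev C)).
  { intros; unfold frac; rewrite map_app, rev_app_distr, map_app.
    now rewrite <- !app_assoc. }
  assert (L : forall Q, Forall (lt (S p)) Q -> Forall (lt p) (map pred Q) /\
    map S (map pred Q) = Q).
  { intros Q HQ; split.
    - apply Forall_map; revert HQ; apply Forall_impl; lia.
    - apply map_S_pred; revert HQ; apply Forall_impl; lia. }
  destruct (L QP HP) as [HP' EP], (L QN HN) as [HN' EN].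
  simpl; rewrite <- !app_assoc; simpl; rewrite !A.
  rewrite <- (eqF_frac_conj p (map pred QP) (map pred QN)), EP, EN by auto.
  reflexivity.
Qed.

Lemma reduce_nil_cons n N d RP RN :
  reduce [] (n :: N) d RP RN = reduce [] N d RP (d + n :: RN).
Proof. reflexivity. Qed.

Lemma reduce_cons_nil p P d RP RN :
  reduce (p :: P) [] d RP RN = reduce P [] d (d + p :: RP) RN.
Proof. reflexivity. Qed.

Lemma reduce_cons_cons p P n N d RP RN :
  reduce (p :: P) (n :: N) d RP RN =
  if n <? p then reduce P (n :: N) d (d + p :: RP) RN
  else if p <? n then reduce (p :: P) N d RP (d + n :: RN)
  else if within (S (d + p)) RP || within (S (d + p)) RN
  then reduce P N d (d + p :: RP) (d + n :: RN)
  else reduce P N (S d) RP RN.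
Proof. reflexivity. Qed.

Lemma reduce_correct P N d RP RN d' RP' RN' :
  pending P N d RP RN -> reduce P N d RP RN = (d', RP', RN') ->
  pending [] [] d' RP' RN' /\
  eqF (frac (rev P ++ lower d RP) (rev N ++ lower d RN))
      (frac (lower d' RP') (lower d' RN')) /\
  length RP' + length RN' <= length P + length N + length RP + length RN.
Proof.
  revert N d RP RN; induction P as [|p P IHP]; intros N.
  - induction N as [|n N IHN]; intros d RP RN H E.
    + injection E as -> -> ->; repeat split; auto; [apply H..|reflexivity].
    + rewrite reduce_nil_cons in E; apply IHN in E.
      * rewrite rev_cons_lower; simpl in *; split; [tauto|split; [tauto|lia]].
      * apply pending_swap, pending_move_P; [now apply pending_swap|easy].
  - induction N as [|n N IHN]; intros d RP RN H E.
    + rewrite reduce_cons_nil in E; apply IHP in E.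
      * rewrite rev_cons_lower; simpl in *; split; [tauto|split; [tauto|lia]].
      * now apply pending_move_P.
    + pose proof (proj1 (pending_le_P _ _ _ _ _ _ H)) as LP.
      pose proof (proj1 (pending_le_P _ _ _ _ _ _ (pending_swap _ _ _ _ _ H))) as LN.
      rewrite reduce_cons_cons in E.
      destruct (Nat.ltb_spec n p); [|destruct (Nat.ltb_spec p n);
        [|assert (p = n) as <- by lia; destruct (_ || _) eqn:EW]].
      * apply IHP in E.
        -- rewrite rev_cons_lower; simpl in *; split; [tauto|split; [tauto|lia]].
        -- apply pending_move_P; auto; intros [|Hp]; [lia|].
           apply LN in Hp; lia.
      * apply IHN in E.
        -- rewrite (rev_cons_lower n); simpl in *.
           split; [tauto|split; [tauto|lia]].
        -- apply pending_swap, pending_move_P; [now apply pending_swap|].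
           intros [|Hp]; [lia|]; apply LP in Hp; lia.
      * apply IHP in E.
        -- rewrite !rev_cons_lower; simpl in *; split; [tauto|split; [tauto|lia]].
        -- now apply pending_move_pair.
      * apply orb_false_elim in EW as [EP EN].
        apply not_within_lower in EP; [|eapply Sorted_app_r, H].
        apply not_within_lower in EN; [|eapply Sorted_app_r, H].
        apply IHP in E; [|eapply pending_remove; eauto].
        rewrite remove_pair_eqF by auto; rewrite <- !lower_S.
        simpl; split; [tauto|split; [tauto|lia]].
Qed.

(** * Reasoning about programs *)

(** [runs p s n Q]: a budget of [n] operations suffices for [p] to reach a
    state with property [Q]. The rules below treat a program as its first
    instruction followed by a continuation, so that proofs execute programs
    symbolically and spend the budget on the way. *)
Definition runs (p : prog) (s : state) (n : nat) (Q : state -> Prop) : Prop :=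
  exists t s', exec p s t s' /\ t <= n /\ Q s'.

Declare Scope prog_scope.
Notation "p ;; q" := (Seq p q) (at level 62, right associativity) : prog_scope.
Open Scope prog_scope.

Lemma runs_mono p s n n' Q : runs p s n Q -> n <= n' -> runs p s n' Q.
Proof. intros (t & s' & H & Ht & HQ) Hn; exists t, s'; repeat split; auto; lia. Qed.

Lemma runs_skip s n (Q : state -> Prop) : Q s -> runs Skip s n Q.
Proof. intros H; exists 0, s; repeat split; auto; [constructor|lia]. Qed.

Lemma runs_skip_seq p s n Q : runs p s n Q -> runs (Skip ;; p) s n Q.
Proof.
  intros (t & s' & H & Ht & HQ); exists (0 + t), s'; repeat split; auto.
  econstructor; eauto; constructor.
Qed.

Lemma runs_assoc p q r s n Q : runs (p ;; q ;; r) s n Q -> runs ((p ;; q) ;; r) s n Q.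
Proof.
  intros (t & s' & H & Ht & HQ); exists t, s'; split; auto.
  inversion H as [| |p0 q0 s0 s1 s2 t1 t2 E1 E2| | |]; subst.
  inversion E2 as [| |p0 q0 s0 s3 s4 t3 t4 E3 E4| | |]; subst.
  rewrite Nat.add_assoc; econstructor; eauto; econstructor; eauto.
Qed.

Lemma runs_do i p s s1 n Q :
  run_instr i s = Some s1 -> 1 <= n -> runs p s1 (n - 1) Q ->
  runs (Do i ;; p) s n Q.
Proof.
  intros Hi Hn (t & s' & H & Ht & HQ); exists (1 + t), s'; split; [|split; [lia|auto]].
  econstructor; eauto; now constructor.
Qed.

Lemma runs_if b c p q r s n Q :
  run_test b s = Some c -> 1 <= n ->
  runs ((if c then p else q) ;; r) s (n - 1) Q -> runs (If b p q ;; r) s n Q.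
Proof.
  intros Hb Hn (t & s' & H & Ht & HQ); exists (S t), s'; split; [|split; [lia|auto]].
  inversion H as [| |p0 q0 s0 s1 s2 t1 t2 E1 E2| | |]; subst.
  change (S (t1 + t2)) with (S t1 + t2); econstructor; eauto; econstructor; eauto.
Qed.

Lemma runs_while b c p r s n Q :
  run_test b s = Some c -> 1 <= n ->
  runs (if c then p ;; While b p ;; r else r) s (n - 1) Q ->
  runs (While b p ;; r) s n Q.
Proof.
  intros Hb Hn (t & s' & H & Ht & HQ); exists (S t), s'; split; [|split; [lia|auto]].
  destruct c.
  - inversion H as [| |p0 q0 s0 s1 s2 t1 t2 E1 E2| | |]; subst.
    inversion E2 as [| |p0 q0 s0 s3 s4 t3 t4 E3 E4| | |]; subst.
    rewrite Nat.add_assoc; change (S (t1 + t3 + t4)) with (S (t1 + t3) + t4).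
    econstructor; eauto; eapply exec_While_step; eauto.
  - change (S t) with (1 + t); econstructor; eauto; now constructor.
Qed.

Lemma update_eq A (f : nat -> A) k a : update f k a k = a.
Proof. unfold update; now rewrite Nat.eqb_refl. Qed.

Lemma update_neq A (f : nat -> A) k a n : n <> k -> update f k a n = f n.
Proof. unfold update; now destruct (Nat.eqb_spec n k). Qed.

Lemma peek_back u a : peek Back (u ++ [a]) = Some a.
Proof. simpl; now rewrite rev_unit. Qed.

Lemma drop_back u a : drop_end Back (u ++ [a]) = u.
Proof. apply removelast_last. Qed.

Lemma ltb_of_nat m n : (Z.of_nat m <? Z.of_nat n)%Z = (m <? n).
Proof. destruct (Nat.ltb_spec m n), (Z.ltb_spec (Z.of_nat m) (Z.of_nat n)); lia. Qed.

Lemma eqb_of_nat m n : (Z.of_nat m =? Z.of_nat n)%Z = (m =? n).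
Proof. destruct (Nat.eqb_spec m n), (Z.eqb_spec (Z.of_nat m) (Z.of_nat n)); lia. Qed.

Lemma leb_of_nat n : (0 <=? Z.of_nat n)%Z = true.
Proof. apply Z.leb_le; lia. Qed.

Lemma of_nat_succ n : (Z.of_nat n + 1)%Z = Z.of_nat (S n).
Proof. lia. Qed.

(** For lack of immediate operands the programs keep 0 and 1 in two counters. *)
Definition constants (s : state) : Prop := counters s 0 = 0%Z /\ counters s 1 = 1%Z.

Notation scratch := [2; 3; 4; 5; 6; 7].

Definition same_but (L C : list nat) (s s' : state) : Prop :=
  (forall l, ~ In l L -> lists s' l = lists s l) /\
  (forall r, ~ In r C -> counters s' r = counters s r).

(** Evaluation of counters and list ends in a state that results from an
    abstract state by assignments. *)
Ltac look :=
  repeat first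
    [ progress cbn [lists counters set_list set_counter]
    | rewrite update_eq
    | rewrite update_neq by (auto; tauto || lia)
    | match goal with
      | H : lists ?s ?l = _ |- context [lists ?s ?l] => rewrite H
      | H : counters ?s ?r = _ |- context [counters ?s ?r] => rewrite H
      | H : same_but _ _ _ ?s |- context [lists ?s ?l] =>
          rewrite (proj1 H l) by (simpl; tauto || lia)
      | H : same_but _ _ _ ?s |- context [counters ?s ?r] =>
          rewrite (proj2 H r) by (simpl; tauto || lia)
      end ];
  rewrite ?peek_back, ?drop_back;
  cbn [peek hd_error drop_end tl add_end option_map fst snd pos neg];
  rewrite <- ?Nat2Z.inj_sub by (auto; lia);
  rewrite <- ?Nat2Z.inj_add, ?of_nat_succ, ?ltb_of_nat, ?eqb_of_nat, ?leb_of_nat,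
    ?Nat2Z.id;
  try reflexivity.

Ltac frame :=
  let x := fresh "x" in let Hx := fresh "Hx" in
  split; intros x Hx; simpl in Hx; look.

Ltac step :=
  lazymatch goal with
  | |- runs ((_ ;; _) ;; _) _ _ _ => apply runs_assoc
  | |- runs (Skip ;; _) _ _ _ => apply runs_skip_seq
  | |- runs (Do _ ;; _) _ _ _ =>
      eapply runs_do; [cbn [run_instr]; look | lia | ]
  | |- runs (If _ _ _ ;; _) _ _ _ =>
      eapply runs_if; [cbn [run_test]; solve [look] | lia | cbv iota]
  end.

Ltac enter_loop :=
  eapply runs_while; [cbn [run_test]; solve [look] | lia | cbv iota]; repeat step.

(** Only positive letters carry data in the queues, so that a negative letter can
    serve as an end mark and the test [IsPos] as the loop condition. *)
Definition queue_block (l : list nat) (u : word) : word := map pos l ++ neg 0 :: u.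

Lemma queue_block_cons a l u : queue_block (a :: l) u = pos a :: queue_block l u.
Proof. reflexivity. Qed.

Lemma queue_block_nil u : queue_block [] u = neg 0 :: u.
Proof. reflexivity. Qed.

Lemma queue_block_app l u v : queue_block l u ++ v = queue_block l (u ++ v).
Proof. unfold queue_block; now rewrite <- app_assoc. Qed.

(** Branching on a test of integers whose outcome [c] is known to [lia]. *)
Ltac decide_test :=
  cbn [run_test]; look; f_equal;
  (apply Z.ltb_lt || apply Z.ltb_ge || apply Z.eqb_eq || apply Z.eqb_neq); lia.

Ltac enter_loop_as c :=
  eapply (runs_while _ c); [decide_test | lia | cbv iota];
  repeat lazymatch goal with
    | |- runs ((_ ;; _) ;; _) _ _ _ => apply runs_assoc
    end.

Ltac branch_as c :=
  eapply (runs_if _ c); [decide_test | lia | cbv iota]; repeat step.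

(** The end of an induction step: the remaining run is covered by the
    continuation hypothesis [K]. *)
Ltac conclude K :=
  intros; eapply runs_mono;
  [apply K; [frame | (look; now rewrite <- ?app_assoc) ..] | simpl; lia].

(** Adding the offset in counter 3 here applies a deferred raising to all letters
    that no opposite letter passes over any more. *)
Definition drain_loop (Y Z : nat) : prog :=
  While (IsPos Front Y)
    (Do (ReadIndex 5 Front Y) ;; Do (Add 5 3 5) ;;
     Do (Append Back Z 5 true) ;; Do (Remove Front Y)).

Definition drain (Y Z : nat) : prog :=
  drain_loop Y Z ;; Do (Remove Front Y) ;; Do (Append Back Z 0 false).

Lemma drain_runs Y Z B d u v s n r Q :
  Y <> Z -> constants s ->
  lists s Y = queue_block B u -> lists s Z = v -> counters s 3 = Z.of_nat d ->
  5 * length B + 3 <= n ->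
  (forall s', same_but [Y; Z] scratch s s' -> lists s' Y = u ->
     lists s' Z = v ++ queue_block (raise d B) [] ->
     runs r s' (n - (5 * length B + 3)) Q) ->
  runs (drain Y Z ;; r) s n Q.
Proof.
  intros HYZ; unfold drain, drain_loop.
  intros C HY HZ Hd Hn K; apply runs_assoc.
  revert v s n C HY HZ Hd Hn K; induction B as [|b B IH];
    intros v s n [C0 C1] HY HZ Hd Hn K.
  - rewrite queue_block_nil in HY; enter_loop; conclude K.
  - rewrite queue_block_cons in HY; simpl length in *; enter_loop.
    eapply IH; [split; look|look..|lia|]; conclude K.
Qed.

(** The offset of [merge] is in counter 2. *)
Definition merge_loop (X Y Z : nat) : prog :=
  While (IsPos Front X)
    (Do (ReadIndex 4 Front X) ;; Do (Add 4 2 4) ;;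
     If (IsPos Front Y)
       (Do (ReadIndex 5 Front Y) ;;
        If (IsLt 5 4)
          (Do (Append Back Z 5 true) ;; Do (Remove Front Y) ;; Do (Add 2 2 1))
          (Do (Append Back Z 4 true) ;; Do (Remove Front X)))
       (Do (Append Back Z 4 true) ;; Do (Remove Front X))).

Definition merge_prog (X Y Z : nat) : prog :=
  Do (Const 2 0) ;; Do (Const 3 0) ;; merge_loop X Y Z ;;
  Do (Remove Front X) ;; drain Y Z.

Lemma merge_loop_runs X Y Z A B c u v w s n r Q :
  X <> Y -> X <> Z -> Y <> Z -> constants s ->
  lists s X = queue_block A u -> lists s Y = queue_block B v -> lists s Z = w ->
  counters s 2 = Z.of_nat c -> counters s 3 = Z.of_nat 0 ->
  10 * (length A + length B) + 5 <= n ->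
  (forall s', same_but [X; Y; Z] scratch s s' -> lists s' X = u -> lists s' Y = v ->
     lists s' Z = w ++ queue_block (merge A c B) [] ->
     runs r s' (n - (10 * (length A + length B) + 5)) Q) ->
  runs (merge_loop X Y Z ;; (Do (Remove Front X) ;; drain Y Z) ;; r) s n Q.
Proof.
  intros HXY HXZ HYZ; unfold merge_loop.
  revert B c w s n; induction A as [|a A IHA]; intros B c w s n.
  - intros C HX HY HZ Hc Hd Hn K; pose proof C as [C0 C1].
    rewrite queue_block_nil in HX; rewrite merge_nil_l in K; enter_loop.
    eapply (drain_runs Y Z B 0); [auto|split; look|look..|lia|].
    rewrite raise_0; conclude K.
  - revert c w s n; induction B as [|b B IHB]; intros c w s n.
    + intros [C0 C1] HX HY HZ Hc Hd Hn K.
      rewrite queue_block_cons in HX; rewrite queue_block_nil in HY.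
      simpl length in *; enter_loop.
      eapply (IHA []); [split; look|look..|simpl; lia|]; conclude K.
    + intros [C0 C1] HX HY HZ Hc Hd Hn K.
      rewrite queue_block_cons in HX, HY.
      rewrite merge_cons_cons in K; simpl length in *; enter_loop.
      destruct (b <? c + a); repeat step.
      * eapply (IHB (S c)); [split; look|look..|simpl; lia|]; conclude K.
      * eapply (IHA (b :: B)); [split; look|look..|simpl; lia|]; conclude K.
Qed.

Lemma merge_runs X Y Z A B u v w s n r Q :
  X <> Y -> X <> Z -> Y <> Z -> constants s ->
  lists s X = queue_block A u -> lists s Y = queue_block B v -> lists s Z = w ->
  10 * (length A + length B) + 7 <= n ->
  (forall s', same_but [X; Y; Z] scratch s s' -> lists s' X = u -> lists s' Y = v ->
     lists s' Z = w ++ queue_block (merge A 0 B) [] ->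
     runs r s' (n - (10 * (length A + length B) + 7)) Q) ->
  runs (merge_prog X Y Z ;; r) s n Q.
Proof.
  intros HXY HXZ HYZ [C0 C1] HX HY HZ Hn K; unfold merge_prog; repeat step.
  eapply (merge_loop_runs X Y Z A B 0); auto; [split; look|look..|lia|].
  conclude K.
Qed.

(** The offsets of [cancel] are in counters 2 and 3. *)
Definition cancel_loop : prog :=
  While (IsPos Front 3)
    (Do (ReadIndex 4 Front 3) ;; Do (Add 4 2 4) ;;
     If (IsPos Front 2)
       (Do (ReadIndex 5 Front 2) ;; Do (Add 5 3 5) ;;
        If (IsEq 4 5)
          (Do (Remove Front 3) ;; Do (Remove Front 2))
          (If (IsLt 4 5)
             (Do (Append Back 6 4 true) ;; Do (Remove Front 3) ;; Do (Add 3 3 1))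
             (Do (Append Back 5 5 true) ;; Do (Remove Front 2) ;; Do (Add 2 2 1))))
       (Do (Append Back 6 4 true) ;; Do (Remove Front 3))).

Definition cancel_prog : prog :=
  Do (Const 2 0) ;; Do (Const 3 0) ;; cancel_loop ;;
  Do (Remove Front 3) ;; drain 2 5 ;; Do (Append Back 6 0 false).

Lemma cancel_loop_runs A B c d u v w x s n r Q :
  constants s ->
  lists s 3 = queue_block A u -> lists s 2 = queue_block B v ->
  lists s 5 = w -> lists s 6 = x ->
  counters s 2 = Z.of_nat c -> counters s 3 = Z.of_nat d ->
  12 * (length A + length B) + 6 <= n ->
  (forall s', same_but [2; 3; 5; 6] scratch s s' -> lists s' 3 = u -> lists s' 2 = v ->
     lists s' 5 = w ++ queue_block (fst (cancel A c d B)) [] ->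
     lists s' 6 = x ++ queue_block (snd (cancel A c d B)) [] ->
     runs r s' (n - (12 * (length A + length B) + 6)) Q) ->
  runs (cancel_loop ;;
    (Do (Remove Front 3) ;; drain 2 5 ;; Do (Append Back 6 0 false)) ;; r) s n Q.
Proof.
  unfold cancel_loop.
  revert B c d w x s n; induction A as [|a A IHA]; intros B c d w x s n.
  - intros C HX HY HZ HW Hc Hd Hn K; pose proof C as [C0 C1].
    rewrite queue_block_nil in HX; rewrite cancel_nil_l in K; enter_loop.
    eapply (drain_runs 2 5 B d); [auto|split; look|look..|lia|].
    intros s' H HY' HZ'; assert (counters s' 0 = 0%Z) by look.
    repeat step; conclude K.
  - revert c d w x s n; induction B as [|b B IHB]; intros c d w x s n.
    + intros [C0 C1] HX HY HZ HW Hc Hd Hn K.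
      rewrite queue_block_cons in HX; rewrite queue_block_nil in HY.
      rewrite cancel_cons_nil in K; simpl length in *; enter_loop.
      eapply (IHA []); [split; look|look..|simpl; lia|]; conclude K.
    + intros [C0 C1] HX HY HZ HW Hc Hd Hn K.
      rewrite queue_block_cons in HX, HY.
      rewrite cancel_cons_cons in K; simpl length in *; enter_loop.
      destruct (c + a =? d + b); repeat step;
        [|destruct (c + a <? d + b); repeat step].
      * eapply (IHA B); [split; look|look..|simpl; lia|]; conclude K.
      * eapply (IHA (b :: B)); [split; look|look..|simpl; lia|]; conclude K.
      * eapply (IHB (S c)); [split; look|look..|simpl; lia|]; conclude K.
Qed.

Lemma cancel_runs A B u v w x s n r Q :
  constants s ->
  lists s 3 = queue_block A u -> lists s 2 = queue_block B v ->
  lists s 5 = w -> lists s 6 = x ->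
  12 * (length A + length B) + 8 <= n ->
  (forall s', same_but [2; 3; 5; 6] scratch s s' -> lists s' 3 = u -> lists s' 2 = v ->
     lists s' 5 = w ++ queue_block (fst (cancel A 0 0 B)) [] ->
     lists s' 6 = x ++ queue_block (snd (cancel A 0 0 B)) [] ->
     runs r s' (n - (12 * (length A + length B) + 8)) Q) ->
  runs (cancel_prog ;; r) s n Q.
Proof.
  intros [C0 C1] HX HY HZ HW Hn K; unfold cancel_prog; repeat step.
  eapply (cancel_loop_runs A B 0 0); [split; look|look..|lia|]; conclude K.
Qed.

(** List 2 is the queue of numerators and list 3 the queue of denominators. The
    factors are taken at the front and the product is put at the back. *)
Definition mul_prog : prog :=
  Do (Const 3 0) ;; drain 2 4 ;; cancel_prog ;; Do (Const 3 0) ;; drain 3 7 ;;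
  merge_prog 4 5 2 ;; merge_prog 7 6 3.

Definition workspace_empty (s : state) : Prop :=
  lists s 4 = [] /\ lists s 5 = [] /\ lists s 6 = [] /\ lists s 7 = [].

Lemma mul_runs x y u v s n r Q :
  constants s -> workspace_empty s ->
  lists s 2 = queue_block (fst x) (queue_block (fst y) u) ->
  lists s 3 = queue_block (snd x) (queue_block (snd y) v) ->
  40 * (size x + size y) + 40 <= n ->
  (forall s', same_but [2; 3; 4; 5; 6; 7] scratch s s' -> workspace_empty s' ->
     lists s' 2 = u ++ queue_block (fst (mul x y)) [] ->
     lists s' 3 = v ++ queue_block (snd (mul x y)) [] ->
     runs r s' (n - (40 * (size x + size y) + 40)) Q) ->
  runs (mul_prog ;; r) s n Q.
Proof.
  unfold size; intros [C0 C1] (E4 & E5 & E6 & E7) H2 H3 Hn K.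
  pose proof (cancel_length (snd x) 0 0 (fst y)) as HL.
  unfold mul_prog; repeat step.
  eapply (drain_runs 2 4 (fst x) 0); [auto|split; look|look..|lia|].
  rewrite raise_0; intros s1 F1 L1 L1'; repeat step.
  eapply cancel_runs; [split; look|look..|lia|].
  intros s2 F2 L2 L2' L2'' L2'''; repeat step.
  eapply (drain_runs 3 7 (snd y) 0); [auto|split; look|look..|lia|].
  rewrite raise_0; intros s3 F3 L3 L3'; repeat step.
  eapply (merge_runs 4 5 2); [auto|auto|auto|split; look|look..|lia|].
  intros s4 F4 L4 L4' L4''; repeat step.
  eapply (merge_runs 7 6 3); [auto|auto|auto|split; look|look..|lia|].
  intros s5 F5 L5 L5' L5''.
  eapply runs_mono; [apply K; [frame|repeat split; look|look..]|lia].
Qed.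

(** ** Passes over the queue of blocks *)

(** The queue of numerators for [f := fst], of denominators for [f := snd]. *)
Definition enc (f : block -> list nat) (bs : list block) (u : word) : word :=
  fold_right (fun x => queue_block (f x)) u bs.

Lemma enc_app f bs u v : enc f bs u ++ v = enc f bs (u ++ v).
Proof.
  induction bs; simpl; [easy|]; now rewrite queue_block_app, IHbs.
Qed.

Lemma enc_nil f u : enc f [] u = u.
Proof. reflexivity. Qed.

Lemma enc_cons f x bs u : enc f (x :: bs) u = queue_block (f x) (enc f bs u).
Proof. reflexivity. Qed.

Lemma enc_cat f bs bs' u : enc f (bs ++ bs') u = enc f bs (enc f bs' u).
Proof. apply fold_right_app. Qed.

Definition total (bs : list block) : nat := list_sum (map size bs).

Lemma total_cons x bs : total (x :: bs) = size x + total bs.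
Proof. reflexivity. Qed.

Definition values (bs : list block) : word := flat_map value bs.

(** A last block without a partner is multiplied by the empty block, so that one
    and the same program treats all blocks. *)
Fixpoint pairs (bs : list block) : list block :=
  match bs with
  | [] => []
  | [x] => [mul ([], []) x]
  | x :: y :: bs' => mul x y :: pairs bs'
  end.

Lemma two_step_ind (P : list block -> Prop) :
  P [] -> (forall x, P [x]) -> (forall x y bs, P bs -> P (x :: y :: bs)) ->
  forall bs, P bs.
Proof.
  intros H0 H1 H2 bs; enough (P bs /\ forall x, P (x :: bs)) by tauto.
  induction bs as [|y bs [IH1 IH2]]; auto.
Qed.

Lemma sorted_block_one : sorted_block ([], []).
Proof. split; constructor. Qed.

Lemma pairs_sorted bs : Forall sorted_block bs -> Forall sorted_block (pairs bs).
Proof.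
  induction bs as [|x|x y bs IH] using two_step_ind; simpl; rewrite ?Forall_cons_iff;
    auto.
  - intros [Hx _]; split; auto; apply mul_sorted; auto using sorted_block_one.
  - intros (Hx & Hy & H); split; auto using mul_sorted.
Qed.

Lemma pairs_eqF bs :
  Forall sorted_block bs -> eqF (values (pairs bs)) (values bs).
Proof.
  unfold values; induction bs as [|x|x y bs IH] using two_step_ind; simpl;
    rewrite ?Forall_cons_iff.
  - reflexivity.
  - intros [Hx _]; rewrite !app_nil_r; rewrite mul_eqF; auto using sorted_block_one.
    reflexivity.
  - intros (Hx & Hy & H); rewrite IH, mul_eqF by auto; now rewrite app_assoc.
Qed.

Lemma pairs_total bs : total (pairs bs) <= total bs.
Proof.
  unfold total; induction bs as [|x|x y bs IH] using two_step_ind; simpl; auto.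
  - pose proof (mul_size ([], []) x); change (size ([], [])) with 0 in *; lia.
  - pose proof (mul_size x y); lia.
Qed.

Lemma pairs_length bs :
  length bs <= 2 * length (pairs bs) <= length bs + 1.
Proof.
  induction bs as [|x|x y bs IH] using two_step_ind; simpl in *; lia.
Qed.

(** Counter 9 counts the blocks that this pass still has to treat, counter 8 the
    products, which queue up behind them. The empty block is put at the front,
    where a factor on the left belongs. *)
Definition pass_loop : prog :=
  While (IsLt 0 9)
    (If (IsEq 9 1)
       (Do (Append Front 2 0 false) ;; Do (Append Front 3 0 false) ;;
        Do (Add 9 9 1))
       Skip ;;
     mul_prog ;; Do (Sub 9 9 1) ;; Do (Sub 9 9 1) ;; Do (Add 8 8 1)).

Definition pass_prog : prog := Do (Copy 9 8) ;; Do (Const 8 0) ;; pass_loop.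

Definition clean (s : state) : Prop :=
  constants s /\ workspace_empty s /\ lists s 1 = [].

Lemma pass_loop_runs bs outs s n r Q :
  clean s -> counters s 8 = Z.of_nat (length outs) ->
  counters s 9 = Z.of_nat (length bs) ->
  lists s 2 = enc fst bs (enc fst outs []) ->
  lists s 3 = enc snd bs (enc snd outs []) ->
  40 * total bs + 60 * length bs + 1 <= n ->
  (forall s', clean s' ->
     counters s' 8 = Z.of_nat (length (outs ++ pairs bs)) ->
     lists s' 2 = enc fst (outs ++ pairs bs) [] ->
     lists s' 3 = enc snd (outs ++ pairs bs) [] ->
     runs r s' (n - (40 * total bs + 60 * length bs + 1)) Q) ->
  runs (pass_loop ;; r) s n Q.
Proof.
  unfold pass_loop.
  revert outs s n; induction bs as [|x|x y bs IH] using two_step_ind;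
    intros outs s n ((C0 & C1) & WE & E1) H8 H9 H2 H3 Hn K; pose proof WE as (W4 & W5 & W6 & W7);
    cbn [pairs length] in *; rewrite ?total_cons in *;
    rewrite ?enc_cons, ?enc_nil in H2, H3.
  - enter_loop_as false; rewrite app_nil_r in K.
    apply runs_mono with (n - 1); [|lia]; apply K; auto.
    repeat split; auto.
  - enter_loop_as true; branch_as true.
    eapply (mul_runs ([], []) x); [split; look|repeat split; look|look..| |].
    + change (size ([], [])) with 0; lia.
    + change (size ([], [])) with 0; intros s1 F1 W1 L2 L3; repeat step.
      enter_loop_as false.
      eapply runs_mono; [apply K|lia].
      * repeat split; try apply W1; look.
      * look; rewrite length_app; simpl; lia.
      * look; now rewrite enc_app, enc_cat.
      * look; now rewrite enc_app, enc_cat.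
  - enter_loop_as true; branch_as false.
    eapply (mul_runs x y); [split; look|repeat split; look|look..|lia|].
    intros s1 F1 W1 L2 L3; repeat step.
    apply (IH (outs ++ [mul x y])).
    + repeat split; try apply W1; look.
    + look; rewrite length_app; simpl; lia.
    + look; lia.
    + look; now rewrite enc_app, enc_app, enc_cat.
    + look; now rewrite enc_app, enc_app, enc_cat.
    + lia.
    + rewrite <- app_assoc; intros; eapply runs_mono; [apply K; auto|lia].
Qed.

Definition passes : prog := While (IsLt 1 8) pass_prog.

(** Each pass halves the number of blocks and is linear, because the total size
    does not grow; so [k] passes suffice for [2 ^ k] blocks. *)
Lemma passes_runs k bs s n r Q :
  bs <> [] -> length bs <= 2 ^ k -> Forall sorted_block bs ->
  clean s -> counters s 8 = Z.of_nat (length bs) ->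
  lists s 2 = enc fst bs [] -> lists s 3 = enc snd bs [] ->
  k * (40 * total bs + 60 * length bs + 4) + 1 <= n ->
  (forall s' x, sorted_block x -> eqF (value x) (values bs) ->
     size x <= total bs -> clean s' ->
     lists s' 2 = queue_block (fst x) [] -> lists s' 3 = queue_block (snd x) [] ->
     runs r s' (n - (k * (40 * total bs + 60 * length bs + 4) + 1)) Q) ->
  runs (passes ;; r) s n Q.
Proof.
  unfold passes, pass_prog.
  revert bs s n; induction k as [|k IH];
    intros bs s n NE Hk HS C H8 H2 H3 Hn K; pose proof C as ((C0 & C1) & WE & E1);
    (destruct bs as [|x bs]; [easy|]; clear NE).
  1, 2: destruct bs as [|y bs].
  1, 3: enter_loop_as false; eapply runs_mono; [apply (K s x); auto|simpl; lia];
    [now inversion HS|unfold values; simpl; now rewrite app_nil_r|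
     unfold total; simpl; lia].
  - simpl in Hk; lia.
  - remember (x :: y :: bs) as bs' eqn:E.
    assert (HL : 2 <= length bs') by (subst; simpl; lia); clear E x y bs.
    pose proof (pairs_length bs') as HP; pose proof (pairs_total bs') as HT.
    assert (Hm : k * (40 * total (pairs bs') + 60 * length (pairs bs') + 4) <=
      k * (40 * total bs' + 60 * length bs' + 4)) by (apply Nat.mul_le_mono_l; lia).
    rewrite Nat.mul_succ_l in Hn, K; rewrite Nat.pow_succ_r' in Hk.
    enter_loop_as true; repeat step.
    apply (pass_loop_runs bs' []); [repeat split; try apply WE; look|look..|lia|].
    cbn [app]; intros s1 C1' H8' H2' H3'.
    apply (IH (pairs bs')); auto using pairs_sorted; [|lia|lia|].
    + intros E; rewrite E in HP; simpl in HP; lia.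
    + intros s2 z Hz Ez Sz C2 L2 L3.
      eapply runs_mono; [apply (K s2 z); auto|lia]; [|lia].
      rewrite Ez; now apply pairs_eqF.
Qed.

Definition letter_block (a : letter) : block :=
  if snd a then ([fst a], []) else ([], [fst a]).

(** Counter 10 is the flag that ends the loop: the test [IsPos] would fail on the
    empty list. *)
Definition load_loop : prog :=
  While (IsLt 0 10)
    (If (IsEmpty 0)
       (Do (Const 10 0))
       (Do (ReadIndex 4 Front 0) ;;
        If (IsPos Front 0) (Do (Append Back 2 4 true)) (Do (Append Back 3 4 true)) ;;
        Do (Remove Front 0) ;;
        Do (Append Back 2 0 false) ;; Do (Append Back 3 0 false) ;;
        Do (Add 8 8 1))).

Lemma load_runs w bs s n r Q :
  clean s -> counters s 10 = 1%Z -> counters s 8 = Z.of_nat (length bs) ->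
  lists s 0 = w -> lists s 2 = enc fst bs [] -> lists s 3 = enc snd bs [] ->
  10 * length w + 4 <= n ->
  (forall s', clean s' ->
     counters s' 8 = Z.of_nat (length (bs ++ map letter_block w)) ->
     lists s' 2 = enc fst (bs ++ map letter_block w) [] ->
     lists s' 3 = enc snd (bs ++ map letter_block w) [] ->
     runs r s' (n - (10 * length w + 4)) Q) ->
  runs (load_loop ;; r) s n Q.
Proof.
  unfold load_loop.
  revert bs s n; induction w as [|[i b] w IH];
    intros bs s n ((C0 & C1) & WE & E1) HF H8 H0 H2 H3 Hn K.
  - simpl in *; rewrite app_nil_r in K; enter_loop_as true; repeat step; enter_loop_as false.
    eapply runs_mono; [apply K|lia]; [repeat split; try apply WE; look|look..].
  - simpl length in *; destruct b; enter_loop_as true; repeat step.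
    + apply (IH (bs ++ [letter_block (i, true)]));
        [repeat split; try apply WE; look|look..|lia|].
      * rewrite length_app; simpl; lia.
      * now rewrite <- app_assoc, enc_app, enc_cat.
      * now rewrite enc_app, enc_cat.
      * rewrite <- app_assoc; intros; eapply runs_mono; [apply K; auto|lia].
    + apply (IH (bs ++ [letter_block (i, false)]));
        [repeat split; try apply WE; look|look..|lia|].
      * rewrite length_app; simpl; lia.
      * now rewrite enc_app, enc_cat.
      * now rewrite <- app_assoc, enc_app, enc_cat.
      * rewrite <- app_assoc; intros; eapply runs_mono; [apply K; auto|lia].
Qed.

(** ** Removal of pairs and output of the result *)

(** The top of the stack is at the back of the list; the end mark is at the
    front. *)
Definition stack (l : list nat) : word := neg 0 :: map pos (rev l).

Lemma stack_nil : stack [] = [] ++ [neg 0].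
Proof. reflexivity. Qed.

Lemma stack_cons a l : stack (a :: l) = stack l ++ [pos a].
Proof. unfold stack; simpl; now rewrite map_app. Qed.

Definition turn (L : nat) : prog :=
  Do (Remove Back L) ;; Do (Append Front L 0 false).

Lemma turn_runs L l s n r Q :
  constants s -> lists s L = queue_block l [] -> 2 <= n ->
  (forall s', same_but [L] scratch s s' -> lists s' L = stack (rev l) ->
     runs r s' (n - 2) Q) ->
  runs (turn L ;; r) s n Q.
Proof.
  intros [C0 C1] HL Hn K; unfold turn, queue_block in *; repeat step.
  eapply runs_mono; [apply K; [frame|look]|lia].
  unfold stack; now rewrite rev_involutive.
Qed.

(** Two checks in a row compute the disjunction in [reduce]: they share the flag
    in counter 3 and the bound in counter 6. *)
Definition check (L : nat) : prog :=
  If (IsPos Front L)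
    (Do (ReadIndex 7 Front L) ;; If (IsLt 6 7) Skip (Do (Const 3 1))) Skip.

Lemma check_runs L l m (f : bool) s n r Q :
  lists s L = queue_block l [] -> counters s 6 = Z.of_nat m ->
  counters s 3 = (if f then 1 else 0)%Z -> 4 <= n ->
  (forall s', same_but [] [3; 7] s s' ->
     counters s' 3 = (if f || within m l then 1 else 0)%Z ->
     runs r s' (n - 4) Q) ->
  runs (check L ;; r) s n Q.
Proof.
  intros HL H6 H3 Hn K; unfold check; destruct l as [|a l]; simpl within in K.
  - rewrite queue_block_nil in HL; repeat step.
    eapply runs_mono; [apply K; [frame|now rewrite orb_false_r]|lia].
  - rewrite queue_block_cons in HL; repeat step.
    destruct (Nat.ltb_spec m a), (Nat.leb_spec a m); try lia; repeat step;
      (eapply runs_mono; [apply K; [frame|look]|lia]);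
      now rewrite ?orb_false_r, ?orb_true_r.
Qed.

Definition move_P : prog :=
  Do (Remove Back 2) ;; Do (Add 4 8 4) ;; Do (Append Front 4 4 true).

Definition move_N : prog :=
  Do (Remove Back 3) ;; Do (Add 5 8 5) ;; Do (Append Front 5 5 true).

(** The arguments [P], [N], [RP], [RN] of [reduce] are in lists 2 to 5, the offset
    [d] is in counter 8. *)
Definition reduce_loop : prog :=
  While (IsPos Back 2)
    (Do (ReadIndex 4 Back 2) ;;
     If (IsPos Back 3)
       (Do (ReadIndex 5 Back 3) ;;
        If (IsLt 5 4) move_P
          (If (IsLt 4 5) move_N
             (Do (Remove Back 2) ;; Do (Remove Back 3) ;; Do (Add 4 8 4) ;;
              Do (Add 6 4 1) ;; Do (Const 3 0) ;; check 4 ;; check 5 ;;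
              If (IsEq 3 1)
                (Do (Append Front 4 4 true) ;; Do (Append Front 5 4 true))
                (Do (Add 8 8 1)))))
       move_P).

Definition reduce_rest : prog :=
  While (IsPos Back 3) (Do (ReadIndex 5 Back 3) ;; move_N).

Lemma reduce_rest_runs N d RP RN s n r Q :
  constants s -> counters s 8 = Z.of_nat d ->
  lists s 3 = stack N ->
  lists s 4 = queue_block RP [] -> lists s 5 = queue_block RN [] ->
  5 * length N + 1 <= n ->
  (forall s' d' RP' RN', reduce [] N d RP RN = (d', RP', RN') ->
     same_but [3; 4; 5] [3; 4; 5; 6; 7; 8] s s' -> counters s' 8 = Z.of_nat d' ->
     lists s' 4 = queue_block RP' [] -> lists s' 5 = queue_block RN' [] ->
     runs r s' (n - (5 * length N + 1)) Q) ->
  runs (reduce_rest ;; r) s n Q.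
Proof.
  unfold reduce_rest, move_N.
  revert RN s n; induction N as [|a N IHN];
    intros RN s n [C0 C1] Hd H3 H4 H5 Hn K.
  - rewrite stack_nil in H3; enter_loop.
    eapply runs_mono; [eapply K; [reflexivity|frame|look..]|simpl; lia].
  - rewrite stack_cons in H3; simpl length in *; enter_loop.
    eapply (IHN (d + a :: RN)); [split; look|look..|lia|].
    rewrite reduce_nil_cons in K; intros s' d' RP' RN' ER F' Hd' H4' H5'.
    eapply runs_mono; [apply (K s' d' RP' RN' ER); [frame|auto..]|lia].
Qed.

Lemma reduce_runs P N d RP RN s n r Q :
  constants s -> counters s 8 = Z.of_nat d ->
  lists s 2 = stack P -> lists s 3 = stack N ->
  lists s 4 = queue_block RP [] -> lists s 5 = queue_block RN [] ->
  25 * (length P + length N) + 2 <= n ->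
  (forall s' d' RP' RN', reduce P N d RP RN = (d', RP', RN') ->
     same_but [2; 3; 4; 5] [3; 4; 5; 6; 7; 8] s s' -> counters s' 8 = Z.of_nat d' ->
     lists s' 4 = queue_block RP' [] -> lists s' 5 = queue_block RN' [] ->
     runs r s' (n - (25 * (length P + length N) + 2)) Q) ->
  runs (reduce_loop ;; reduce_rest ;; r) s n Q.
Proof.
  unfold reduce_loop, move_P, move_N.
  revert N d RP RN s n; induction P as [|p P IHP]; intros N.
  - intros d RP RN s n [C0 C1] Hd H2 H3 H4 H5 Hn K.
    rewrite stack_nil in H2; enter_loop.
    eapply (reduce_rest_runs N d RP RN); [split; look|look..|simpl in Hn; lia|].
    intros s' d' RP' RN' ER F' Hd' H4' H5'.
    eapply runs_mono; [apply (K s' d' RP' RN' ER); [frame|auto..]|simpl; lia].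
  - induction N as [|a N IHN]; intros d RP RN s n [C0 C1] Hd H2 H3 H4 H5 Hn K;
      simpl length in *.
    + rewrite stack_cons in H2; rewrite stack_nil in H3; enter_loop.
      eapply (IHP [] d (d + p :: RP)); [split; look|look..|simpl; lia|].
      rewrite reduce_cons_nil in K; intros s' d' RP' RN' ER F' Hd' H4' H5'.
      eapply runs_mono; [apply (K s' d' RP' RN' ER); [frame|auto..]|simpl; lia].
    + rewrite stack_cons in H2, H3; rewrite reduce_cons_cons in K; enter_loop.
      destruct (Nat.ltb_spec a p); repeat step;
        [|destruct (Nat.ltb_spec p a); repeat step].
      * eapply (IHP (a :: N) d (d + p :: RP));
          [split; look|rewrite ?stack_cons; look..|simpl; lia|].
        intros s' d' RP' RN' ER F' Hd' H4' H5'.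
        eapply runs_mono; [apply (K s' d' RP' RN' ER); [frame|auto..]|simpl; lia].
      * eapply (IHN d RP (d + a :: RN));
          [split; look|rewrite ?stack_cons; look..|simpl; lia|].
        intros s' d' RP' RN' ER F' Hd' H4' H5'.
        eapply runs_mono; [apply (K s' d' RP' RN' ER); [frame|auto..]|simpl; lia].
      * assert (a = p) as -> by lia.
        eapply (check_runs 4 RP (S (d + p)) false); [look..|lia|].
        intros s1 F1 H1; apply runs_assoc; eapply (check_runs 5 RN); [look..|lia|].
        intros s2 F2 HF; cbn [orb] in HF.
        destruct (within (S (d + p)) RP || within (S (d + p)) RN).
        -- branch_as true.
           eapply (IHP N d (d + p :: RP) (d + p :: RN)); [split; look|look..|lia|].
           intros s' d' RP' RN' ER F' Hd' H4' H5'.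
           eapply runs_mono; [apply (K s' d' RP' RN' ER); [frame|auto..]|lia].
        -- branch_as false.
           eapply (IHP N (S d) RP RN); [split; look|look..|lia|].
           intros s' d' RP' RN' ER F' Hd' H4' H5'.
           eapply runs_mono; [apply (K s' d' RP' RN' ER); [frame|auto..]|lia].
Qed.

Definition emit_pos : prog :=
  While (IsPos Front 4)
    (Do (ReadIndex 4 Front 4) ;; Do (Remove Front 4) ;; Do (Sub 4 4 8) ;;
     Do (Append Back 1 4 true)).

Definition emit_neg : prog :=
  While (IsPos Back 5)
    (Do (ReadIndex 4 Back 5) ;; Do (Remove Back 5) ;; Do (Sub 4 4 8) ;;
     Do (Append Back 1 4 false)).

Lemma emit_pos_runs l d w s n r Q :
  Forall (le d) l -> counters s 8 = Z.of_nat d ->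
  lists s 4 = queue_block l [] -> lists s 1 = w -> 5 * length l + 1 <= n ->
  (forall s', same_but [1; 4] scratch s s' -> lists s' 1 = w ++ map pos (lower d l) ->
     runs r s' (n - (5 * length l + 1)) Q) ->
  runs (emit_pos ;; r) s n Q.
Proof.
  unfold emit_pos; revert w s n; induction l as [|a l IH]; intros w s n F Hd H4 H1 Hn K.
  - rewrite queue_block_nil in H4; enter_loop; simpl in K; rewrite app_nil_r in K.
    apply K; [frame|look].
  - rewrite queue_block_cons in H4; apply Forall_cons_iff in F as [Fa F].
    simpl length in *; enter_loop.
    eapply IH; [auto|look..|lia|]; conclude K.
Qed.

Lemma emit_neg_runs l d w s n r Q :
  Forall (le d) l -> counters s 8 = Z.of_nat d ->
  lists s 5 = stack l -> lists s 1 = w -> 5 * length l + 1 <= n ->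
  (forall s', same_but [1; 5] scratch s s' -> lists s' 1 = w ++ map neg (lower d l) ->
     runs r s' (n - (5 * length l + 1)) Q) ->
  runs (emit_neg ;; r) s n Q.
Proof.
  unfold emit_neg; revert w s n; induction l as [|a l IH]; intros w s n F Hd H5 H1 Hn K.
  - rewrite stack_nil in H5; enter_loop; simpl in K; rewrite app_nil_r in K.
    apply K; [frame|look].
  - rewrite stack_cons in H5; apply Forall_cons_iff in F as [Fa F].
    simpl length in *; enter_loop.
    eapply IH; [auto|look..|lia|]; conclude K.
Qed.

(** * The algorithm *)

(** The empty block that is queued before the input is loaded guarantees that at
    least one block exists, even for the empty word. *)
Definition normal_form_prog : prog :=
  Do (Const 1 1) ;; Do (Const 8 1) ;; Do (Const 10 1) ;;
  Do (Append Back 2 0 false) ;; Do (Append Back 3 0 false) ;;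
  load_loop ;; passes ;; turn 2 ;; turn 3 ;;
  Do (Append Back 4 0 false) ;; Do (Append Back 5 0 false) ;; Do (Const 8 0) ;;
  reduce_loop ;; reduce_rest ;; emit_pos ;; turn 5 ;; emit_neg ;; Skip.

Lemma values_letter_blocks w : values (map letter_block w) = w.
Proof.
  induction w as [|[i [|]] w IH]; simpl; [easy| |]; now rewrite IH.
Qed.

Lemma total_letter_blocks w : total (map letter_block w) = length w.
Proof.
  unfold total; induction w as [|[i [|]] w IH]; simpl in *; lia.
Qed.

Lemma sorted_letter_blocks w : Forall sorted_block (map letter_block w).
Proof.
  apply Forall_map, Forall_forall; intros [i [|]] _;
    split; simpl; repeat constructor.
Qed.

Lemma normal_form_prog_runs w k :
  length w < 2 ^ k ->
  runs normal_form_prog (initial_state w) ((k + 1) * (100 * length w + 100))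
    (fun s => is_normal_form_of w (output s)).
Proof.
  intros Hk.
  (* [k] passes over [length w + 1] blocks, and the linear loops around them *)
  assert (HB : k * (40 * length w + 60 * S (length w) + 4) + 50 * length w + 50 <=
               (k + 1) * (100 * length w + 100)) by nia.
  remember ((k + 1) * (100 * length w + 100)) as n eqn:En; clear En.
  unfold normal_form_prog, initial_state.
  set (s := State _ _).
  assert (HL : forall l, lists s (S l) = []) by reflexivity.
  assert (H0 : lists s 0 = w) by reflexivity.
  assert (HC : forall r, counters s r = 0%Z) by reflexivity.
  clearbody s.
  pose proof (HL 0) as L1; pose proof (HL 1) as L2; pose proof (HL 2) as L3;
  pose proof (HL 3) as L4; pose proof (HL 4) as L5; pose proof (HL 5) as L6;
  pose proof (HL 6) as L7; pose proof (HC 0) as C0.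
  repeat step.
  apply (load_runs w [([], [])]); [repeat split; look|look..|lia|].
  cbn [app]; intros s1 K1 H8 H2 H3.
  apply (passes_runs k (([], []) :: map letter_block w)); auto.
  - easy.
  - simpl; rewrite length_map; lia.
  - constructor; auto using sorted_letter_blocks, sorted_block_one.
  - rewrite total_cons, total_letter_blocks; simpl length; rewrite length_map.
    change (size ([], [])) with 0; simpl plus; lia.
  - rewrite total_cons, total_letter_blocks; simpl length; rewrite length_map.
    change (size ([], [])) with 0; simpl plus.
    intros s2 [P N] [SP SN] EV SZ ([C2 C2'] & (W4 & W5 & W6 & W7) & E1) M2 M3.
    unfold size in SZ; simpl in M2, M3, SP, SN, SZ.
    apply (turn_runs 2 P); [split; auto|auto|lia|]; intros s3 F3 T2.
    apply (turn_runs 3 N); [split; look|look|lia|]; intros s4 F4 T3.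
    assert (C4 : constants s4) by (split; look).
    destruct C4 as [C4 C4'].
    repeat step.
    apply (reduce_runs (rev P) (rev N) 0 [] []); [split; look|look..| |].
    { rewrite !length_rev; lia. }
    rewrite !length_rev; intros s5 d RP RN ER F5 H8' R4 R5.
    apply reduce_correct in ER as (HR & EF & LR).
    + rewrite !rev_involutive in EF; unfold lower at 1 2 in EF; simpl map in EF.
      rewrite !app_nil_r in EF; rewrite !length_rev in LR; simpl in LR.
      destruct HR as [SP' SN' BP BN HR]; simpl in SP', SN'.
      apply (emit_pos_runs RP d []); [auto..|look|lia|]; intros s6 F6 O6.
      apply (turn_runs 5 RN); [split; look|look|lia|]; intros s7 F7 T7.
      apply (emit_neg_runs (rev RN) d (map pos (lower d RP))); [now apply Forall_rev|look..| |].
      { rewrite length_rev; lia. }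
      intros s8 F8 O8; apply runs_skip; unfold output; rewrite O8.
      unfold lower at 2; rewrite map_rev.
      change (map (fun x => x - d) RN) with (lower d RN).
      apply is_normal_form_frac; auto.
      * intros i HP HN; apply HR; tauto.
      * unfold values in EV; simpl in EV; fold (values (map letter_block w)) in EV.
        rewrite values_letter_blocks in EV; rewrite <- EV; exact EF.
    + constructor; simpl; rewrite ?rev_involutive, ?app_nil_r; auto.
      intros i [[H _]|[_ H]]; destruct H.
Qed.

Lemma log2_le_ln n :
  2 <= n -> (INR (Nat.log2 n) * ln 2 <= ln (INR n))%R.
Proof.
  intros Hn; rewrite <- ln_pow by lra.
  assert (H : (2 ^ Nat.log2 n <= INR n)%R).
  { change 2%R with (INR 2); rewrite <- pow_INR; apply le_INR.
    apply Nat.log2_spec; lia. }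
  destruct H as [H|H]; [left; apply ln_increasing; auto|right; now rewrite H].
  apply pow_lt; lra.
Qed.

Theorem theorem1 :
  exists (p : prog) (C : R),
    forall w : word,
      exists (t : nat) (s : state),
        exec p (initial_state w) t s /\
        is_normal_form_of w (output s) /\
        (2 <= length w ->
         (INR t <= C * (INR (length w) * ln (INR (length w))))%R).
Proof.
  assert (Hln : (0 < ln 2)%R) by (pose proof ln_lt_2; lra).
  exists normal_form_prog, (450 / ln 2)%R; intros w.
  destruct (normal_form_prog_runs w (S (Nat.log2 (length w)))) as (t & s & E & Ht & HN).
  { destruct (length w) as [|n]; [simpl; lia|apply Nat.log2_spec; lia]. }
  exists t, s; split; [exact E|split; [exact HN|]]; intros Hw.
  assert (Hlog : 1 <= Nat.log2 (length w)) by (apply (Nat.log2_le_mono 2); lia).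
  (* For [n = length w] and [k = log2 n + 1] passes, [k + 1 <= 3 log2 n] and
     [100 n + 100 <= 150 n]. *)
  assert (Ht' : t <= 450 * (length w * Nat.log2 (length w))) by nia.
  apply le_INR in Ht'; rewrite !mult_INR in Ht'.
  replace (INR 450) with 450%R in Ht' by (simpl; lra).
  pose proof (log2_le_ln _ Hw) as HL.
  apply (Rle_trans _ _ _ Ht').
  replace (450 / ln 2 * (INR (length w) * ln (INR (length w))))%R
    with (450 * (INR (length w) * (ln (INR (length w)) / ln 2)))%R by (field; lra).
  apply Rmult_le_compat_l; [lra|]; apply Rmult_le_compat_l; [apply pos_INR|].
  apply Rmult_le_reg_r with (ln 2); [lra|].
  unfold Rdiv; rewrite Rmult_assoc, Rinv_l by lra; lra.
Qed.
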